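(* For every integer $m\geq 2$, $$f(m,m,m;2)=8m-5+\left\lfloor\frac{2m-2}{3}\right\rfloor+\delta,$$ where $\delta=1$ if $m\in\{2,5\}$ and $\delta=0$ otherwise.
   Context: For real numbers $a\le b$, $[a,b]$ denotes the set of integers $x$ with $a\le x\le b$. For a finite set $X\subseteq\mathbb Z$, $\mathrm{diam}(X)=\max(X)-\min(X)$. For finite sets $X,Y\subseteq \mathbb Z$, write $X<_p Y$ if $\max(X)<\min(Y)$. A set $B\subseteq[1,N]$ is monochromatic under a coloring $\Delta:[1,N]\to\{0,1\}$ if $\Delta$ is constant on $B$; an $m$-set is a set with exactly $m$ elements. $f(m,m,m;2)$ is the least integer $N$ such that for every $2$-coloring $\Delta:[1,N]\to\{0,1\}$ there exist three monochromatic $m$-sets $B_1,B_2,B_3\subseteq[1,N]$ (not necessarily of the same color) with $B_1<_p B_2<_p B_3$ and $\mathrm{diam}(B_1)\le\mathrm{diam}(B_2)\le\mathrm{diam}(B_3)$. *)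

(* Defs.v *)
From mathcomp Require Import all_boot.
From mathcomp Require Import finmap.

Set Implicit Arguments.
Unset Strict Implicit.
Unset Printing Implicit Defensive.

(* All sets in play are subsets of [1, N], so integers are represented in nat. *)

Definition fsmax (X : {fset nat}) : nat := \max_(x <- X) x.

(* Seeding the fold with fsmax X makes this the true minimum whenever X is
   nonempty; the value on the empty set is 0. *)
Definition fsmin (X : {fset nat}) : nat := \big[minn/fsmax X]_(x <- X) x.

Definition diam (X : {fset nat}) : nat := fsmax X - fsmin X.

Definition precedes (X Y : {fset nat}) : Prop := fsmax X < fsmin Y.

Definition in_interval (N : nat) (B : {fset nat}) : Prop :=
  forall x, x \in B -> 1 <= x <= N.

Definition monochromatic (Delta : nat -> bool) (B : {fset nat}) : Prop :=
  exists c : bool, forall x, x \in B -> Delta x = c.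

Definition mono_mset (m N : nat) (Delta : nat -> bool) (B : {fset nat}) : Prop :=
  [/\ in_interval N B, #|` B| = m & monochromatic Delta B].

(* A coloring of [1, N] is given by a total function; only its values on
   [1, N] matter, since every B i is contained in [1, N]. *)
Definition forces_triple (m N : nat) : Prop :=
  forall Delta : nat -> bool,
  exists B1 B2 B3 : {fset nat},
    [/\ mono_mset m N Delta B1, mono_mset m N Delta B2 & mono_mset m N Delta B3]
    /\ [/\ precedes B1 B2, precedes B2 B3, diam B1 <= diam B2
         & diam B2 <= diam B3].

Definition is_least (P : nat -> Prop) (N : nat) : Prop :=
  P N /\ forall N', P N' -> N <= N'.

(* is_f m N : f(m, m, m; 2) exists and equals N. *)
Definition is_f (m N : nat) : Prop := is_least (forces_triple m) N.

Definition delta (m : nat) : nat := if (m == 2) || (m == 5) then 1 else 0.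

(* Main.v *)
(* Write n = m - 1.  A monochromatic m-set is determined, as far as order and
   diameters go, by its convex hull, a "good" interval: both ends have the same
   colour and at least n + 1 letters have it.  The first 2n + 1 letters always
   contain a set of diameter at most 2n, so on the remaining word of length
   M = 6n + 2 + k it suffices to find either two disjoint good intervals with
   2n <= d2 <= d3 or three with d1 <= d2 <= d3; a good interval that can serve
   as the middle one is called "legal", and a word without such a
   configuration "free".

   Let the last letter be a one, and suppose that the word is free.
   If there are at least n + 1 ones after position 3n + 1, every one z that has
   n further ones behind it starts a good interval [z, M], so a legal interval
   ending before z has diameter above M - z.  Applied to the last one q up to
   3n + 1 and to the next one z, this leaves no legal interval before q and
   only very wide ones before z, which determines the prefix up to q almost
   completely; short windows of n + 1 ones in it, followed by blocks of the
   zeros after q, then give the contradiction.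
   Otherwise every legal interval [x, y] satisfies 2y - x >= 5n + 2 + k.  The
   first good interval of diameter at least 2n then contains exactly n + 1
   letters of the colour of its ends, the other colour has a short window
   inside it, and this window is the first of three sets.
   The value of k enters through 3k + 2 >= 2n and 2k >= n + 1. *)

From Stdlib Require Import Arith Lia Bool List Classical.

(** * Words and good intervals *)

Ltac splits := repeat match goal with |- _ /\ _ => split end; try assumption; try lia.

Fixpoint cn (w : nat -> bool) (c : bool) (i : nat) : nat :=
  match i with
  | 0 => 0
  | S j => cn w c j + (if Bool.eqb (w (S j)) c then 1 else 0)
  end.

(** Here [t] is the rank of [p] inside its colour class. Working with ranks and positions together
    turns statements about words into linear arithmetic. *)
Definition pos (w : nat -> bool) (c : bool) (t p : nat) : Prop :=
  1 <= p /\ w p = c /\ cn w c p = t.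

Lemma cn_sum w i : cn w true i + cn w false i = i.
Proof. induction i as [|i IH]; simpl; [|destruct (w (S i)); simpl]; lia. Qed.

Lemma cn_sumc w c i : cn w c i + cn w (negb c) i = i.
Proof. pose proof (cn_sum w i); destruct c; simpl; lia. Qed.

Lemma cn_lip w c i j : i <= j -> cn w c i <= cn w c j /\ cn w c j + i <= cn w c i + j.
Proof.
  induction 1 as [|j Hij IH]; simpl; [|destruct (Bool.eqb (w (S j)) c)]; lia.
Qed.

Lemma pos_pred w c t p : pos w c t p -> exists p', p = S p' /\ t = S (cn w c p').
Proof.
  intros (Hp & Hw & Ht); destruct p as [|p']; [lia|].
  exists p'; split; [reflexivity|]; simpl in Ht; rewrite Hw in Ht.
  destruct c; simpl in Ht; lia.
Qed.

Lemma pos_range w c t p : pos w c t p -> 1 <= t <= p.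
Proof.
  intros H; destruct (pos_pred _ _ _ _ H) as (p' & -> & ->).
  pose proof (cn_lip w c 0 p' ltac:(lia)); simpl in *; lia.
Qed.

Lemma pos_cn w c t p i : pos w c t p ->
  (p <= i /\ t <= cn w c i) \/ (i < p /\ cn w c i < t).
Proof.
  intros H; destruct (pos_pred _ _ _ _ H) as (p' & -> & ->); destruct H as (_ & _ & H).
  destruct (le_lt_dec (S p') i) as [Hi|Hi].
  - pose proof (cn_lip w c _ _ Hi); lia.
  - pose proof (cn_lip w c i p' ltac:(lia)); lia.
Qed.

Lemma pos_same w c s x t y : pos w c s x -> pos w c t y ->
  (s < t /\ x < y /\ x + t <= y + s) \/ (s = t /\ x = y) \/
  (t < s /\ y < x /\ y + s <= x + t).
Proof.
  intros Hx Hy.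
  pose proof (pos_cn _ _ _ _ y Hx); pose proof (pos_cn _ _ _ _ x Hy).
  destruct Hx as (_ & _ & Hx); destruct Hy as (_ & _ & Hy).
  destruct (le_lt_dec x y) as [H1|H1].
  - pose proof (cn_lip w c _ _ H1); lia.
  - pose proof (cn_lip w c y x ltac:(lia)); lia.
Qed.

Lemma pos_le w c s x t y : pos w c s x -> pos w c t y -> s <= t -> x + t <= y + s.
Proof. intros Hx Hy H; pose proof (pos_same _ _ _ _ _ _ Hx Hy); lia. Qed.

(** Exactly [x - s] zeros lie up to [x] and [y - t] ones up to [y]; comparing these counts with the
    ranks decides the order. *)
Lemma pos_opp w s x t y : pos w true s x -> pos w false t y ->
  (x < y /\ x < s + t /\ s + t <= y) \/ (y < x /\ y < s + t /\ s + t <= x).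
Proof.
  intros Hx Hy.
  pose proof (pos_cn _ _ _ _ y Hx); pose proof (pos_cn _ _ _ _ x Hy).
  destruct Hx as (_ & Wx & Hx); destruct Hy as (_ & Wy & Hy).
  pose proof (cn_sum w x); pose proof (cn_sum w y).
  assert (x <> y) by congruence; lia.
Qed.

Lemma pos_ex w c t i : 1 <= t <= cn w c i -> exists p, pos w c t p /\ p <= i.
Proof.
  induction i as [|i IH]; simpl; intros H; [lia|].
  destruct (le_lt_dec t (cn w c i)) as [H1|H1].
  - destruct IH as (p & Hp & Hi); [lia|]; exists p; split; [exact Hp|lia].
  - destruct (Bool.eqb (w (S i)) c) eqn:E; [|lia].
    exists (S i); split; [|lia]; split; [lia|]; split.
    + now apply Bool.eqb_prop.
    + simpl; rewrite E; lia.
Qed.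

Lemma pos_here w p : 1 <= p ->
  pos w true (cn w true p) p \/ pos w false (cn w false p) p.
Proof. intros H; destruct (w p) eqn:E; [left|right]; repeat split; auto. Qed.

Definition good n w c x y : Prop :=
  exists s t, pos w c s x /\ pos w c t y /\ s + n <= t.

Definition legal n w x y : Prop :=
  (exists c, good n w c x y) /\
  (x + 2 * n <= y \/
   exists c u v, good n w c u v /\ v < x /\ v + x <= y + u).

(** Diameters are compared through sums because subtraction on [nat] truncates. A bound on [v]
    suffices, as everything else lies to its left. *)
Definition free n M w : Prop :=
  forall x y, legal n w x y ->
  forall c u v, good n w c u v -> y < u -> v <= M -> v + x < u + y.

Lemma free1 n M w : free n M w -> forall c s x t y c' s' u t' v,
  pos w c s x -> pos w c t y -> pos w c' s' u -> pos w c' t' v ->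
  s + n <= t -> x + 2 * n <= y -> s' + n <= t' -> y < u -> v <= M -> v + x < u + y.
Proof.
  intros F c s x t y c' s' u t' v Hx Hy Hu Hv H1 H2 H3 H4 H5.
  apply (F x y) with (c := c'); auto; [split; [|left; lia]|]; unfold good; eauto 7.
Qed.

Lemma free2 n M w : free n M w -> forall c0 s0 a t0 b c s x t y c' s' u t' v,
  pos w c0 s0 a -> pos w c0 t0 b ->
  pos w c s x -> pos w c t y -> pos w c' s' u -> pos w c' t' v ->
  s0 + n <= t0 -> b < x -> b + x <= y + a ->
  s + n <= t -> s' + n <= t' -> y < u -> v <= M -> v + x < u + y.
Proof.
  intros F c0 s0 a t0 b c s x t y c' s' u t' v Ha Hb Hx Hy Hu Hv G1 G2 G3 H1 H3 H4 H5.
  apply (F x y) with (c := c'); auto; [split; [|right]|].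
  - unfold good; eauto 7.
  - exists c0, a, b; unfold good; split; [eauto 7|lia].
  - unfold good; eauto 7.
Qed.

Lemma cn_negb w c i : cn (fun p => negb (w p)) c i = cn w (negb c) i.
Proof.
  induction i as [|i IH]; simpl; [reflexivity|]; rewrite IH.
  now destruct (w (S i)), c.
Qed.

Lemma pos_negb w c t p : pos (fun p => negb (w p)) c t p <-> pos w (negb c) t p.
Proof.
  unfold pos; rewrite cn_negb; destruct (w p), c; simpl; intuition congruence.
Qed.

Lemma good_negb n w c x y : good n (fun p => negb (w p)) c x y <-> good n w (negb c) x y.
Proof.
  unfold good; split; intros (s & t & H1 & H2 & H3); exists s, t;
    apply pos_negb in H1, H2; auto.
Qed.

Lemma legal_negb n w x y : legal n (fun p => negb (w p)) x y -> legal n w x y.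
Proof.
  intros [[c H] G]; split; [exists (negb c); now apply good_negb|].
  destruct G as [G|(c' & u & v & G & K)]; [now left|right].
  exists (negb c'), u, v; split; [now apply good_negb|exact K].
Qed.

Lemma free_negb n M w : free n M w -> free n M (fun p => negb (w p)).
Proof.
  intros F x y L c u v G; apply (F x y (legal_negb _ _ _ _ L) (negb c)).
  now apply good_negb.
Qed.

(* Either end of the interval can only be cut by a short run, except when it
   starts with [n + 1] letters of one colour and ends with [n + 1] of the other. *)
Lemma interval_good n w a D : 1 <= a -> 2 * n <= D ->
  (exists c s x t y, pos w c s x /\ pos w c t y /\ s + n <= t /\
     a <= x /\ y <= a + D /\ x + D <= y + n) \/
  (exists c, cn w c (a + n) = cn w c (a - 1) + n + 1 /\
     cn w (negb c) (a + D) = cn w (negb c) (a + D - n - 1) + n + 1).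
Proof.
  intros Ha HD.
  set (c := w a).
  assert (Pa : pos w c (cn w c a) a) by (repeat split; auto).
  destruct (pos_pred _ _ _ _ Pa) as (a' & Ea & Ca).
  assert (Ea' : a - 1 = a') by lia.
  destruct (pos_ex w c (cn w c (a + D)) (a + D)) as (l & Pl & Hl).
  { pose proof (pos_range _ _ _ _ Pa); pose proof (cn_lip w c a (a + D) ltac:(lia)); lia. }
  pose proof (pos_same _ _ _ _ _ _ Pa Pl) as C1.
  pose proof (cn_lip w c a (a + D) ltac:(lia)) as C2.
  pose proof (cn_sumc w c (a + D)) as S1; pose proof (cn_sumc w c a') as S2.
  pose proof (cn_sumc w c l) as S3; pose proof (cn_sumc w c a) as S4.
  assert (El : cn w c l = cn w c (a + D)) by apply Pl.
  destruct (le_lt_dec (cn w c (a + D)) (cn w c a + n - 1)) as [Hc|Hc].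
  (* The window has at most [n] letters of the colour of its first letter, so the letters of the
     other colour span at least [D - n]. *)
  - left.
    destruct (pos_ex w (negb c) (cn w (negb c) (a + D)) (a + D)) as (y & Py & Hy); [lia|].
    destruct (pos_ex w (negb c) (cn w (negb c) a + 1) (a + D)) as (x & Px & Hx); [lia|].
    exists (negb c), (cn w (negb c) a + 1), x, (cn w (negb c) (a + D)), y.
    pose proof (pos_cn _ _ _ _ a Px); pose proof (cn_sumc w c x); pose proof (cn_sumc w c y).
    assert (cn w (negb c) x = cn w (negb c) a + 1) by apply Px.
    assert (cn w (negb c) y = cn w (negb c) (a + D)) by apply Py.
    pose proof (pos_same _ _ _ _ _ _ Px Py) as C3.
    pose proof (cn_lip w c x y ltac:(lia)).
    splits.
  - destruct (le_lt_dec (a + D) (l + n)) as [H1|H1].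
    + left; exists c, (cn w c a), a, (cn w c (a + D)), l; splits.
    (* The last letter of colour [c] is more than [n] before the end, so the final [n + 1] letters
       all have the other colour. *)
    + assert (Q1 : cn w (negb c) (a + D) = cn w (negb c) (a + D - n - 1) + n + 1).
      { pose proof (cn_lip w c l (a + D - n - 1) ltac:(lia)).
        pose proof (cn_lip w c (a + D - n - 1) (a + D) ltac:(lia)).
        pose proof (cn_sumc w c (a + D - n - 1)); lia. }
      destruct (le_lt_dec (cn w (negb c) (a + n)) (cn w (negb c) a')) as [H2|H2].
      * right; exists c; split; [|exact Q1]; rewrite Ea'.
        pose proof (cn_sumc w c (a + n)).
        pose proof (cn_lip w (negb c) a' (a + n) ltac:(lia)); lia.
      * left.
        destruct (pos_ex w (negb c) (cn w (negb c) a' + 1) (a + n)) as (x & Px & Hx); [lia|].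
        destruct (pos_ex w (negb c) (cn w (negb c) (a + D)) (a + D)) as (y & Py & Hy); [lia|].
        assert (y = a + D).
        { pose proof (pos_cn _ _ _ _ (a + D - 1) Py).
          pose proof (cn_lip w (negb c) (a + D - n - 1) (a + D - 1) ltac:(lia)).
          pose proof (cn_lip w (negb c) (a + D - 1) (a + D) ltac:(lia)). lia. }
        exists (negb c), (cn w (negb c) a' + 1), x, (cn w (negb c) (a + D)), y.
        pose proof (pos_cn _ _ _ _ a' Px).
        pose proof (cn_lip w (negb c) a' (a + D - n - 1) ltac:(lia)).
        splits.
Qed.

(** * Many letters of the last colour at the end *)

(* [q] and [z] are consecutive ones, so all letters strictly between them are zeros. *)
Record late_ones n k w O q z I : Prop := LateOnes {
  lo_free : free n (6 * n + 2 + k) w;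
  lo_q : pos w true O q;
  lo_z : pos w true (O + 1) z;
  lo_M : pos w true I (6 * n + 2 + k);
  lo_qle : q <= 3 * n + 1;
  lo_zge : 3 * n + 2 <= z;
  lo_I : O + n + 1 <= I
}.

Lemma lo_zero n k w O q z I p : late_ones n k w O q z I ->
  q < p -> p < z -> pos w false (p - O) p.
Proof.
  intros [F Pq Pz PM ? ? ?] H1 H2.
  pose proof (pos_cn _ _ _ _ p Pq); pose proof (pos_cn _ _ _ _ p Pz).
  pose proof (cn_sum w p).
  destruct (pos_here w p) as [P|P]; [lia|..].
  - pose proof (pos_same _ _ _ _ _ _ P Pq); pose proof (pos_same _ _ _ _ _ _ P Pz); lia.
  - replace (p - O) with (cn w false p) by lia; exact P.
Qed.

(** A wide interval there would be followed by the good interval from [q] to [6n + 2 + k], which is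
    longer because [q <= 3n + 1]. *)
Lemma lo_before_q n k w O q z I c s x t y : late_ones n k w O q z I ->
  pos w c s x -> pos w c t y -> s + n <= t -> y < q -> y < x + 2 * n.
Proof.
  intros [F Pq Pz PM ? ? ?] Hx Hy H1 H2.
  pose proof (pos_range _ _ _ _ Hx).
  destruct (le_lt_dec (x + 2 * n) y) as [H3|H3]; [|exact H3].
  pose proof (free1 _ _ _ F _ _ _ _ _ _ _ _ _ _ Hx Hy Pq PM); lia.
Qed.

Lemma lo_before_z n k w O q z I c s x t y : late_ones n k w O q z I ->
  pos w c s x -> pos w c t y -> s + n <= t -> x + 2 * n <= y -> y < z ->
  6 * n + 2 + k + x < z + y.
Proof.
  intros [F Pq Pz PM ? ? ?] Hx Hy H1 H2 H3.
  pose proof (free1 _ _ _ F _ _ _ _ _ _ _ _ _ _ Hx Hy Pz PM); lia.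
Qed.

Lemma lo_before_z2 n k w O q z I c0 s0 a t0 b c s x t y : late_ones n k w O q z I ->
  pos w c0 s0 a -> pos w c0 t0 b -> pos w c s x -> pos w c t y ->
  s0 + n <= t0 -> b < x -> b + x <= y + a -> s + n <= t -> y < z ->
  6 * n + 2 + k + x < z + y.
Proof.
  intros [F Pq Pz PM ? ? ?] Ha Hb Hx Hy ? ? ? ? ?.
  pose proof (free2 _ _ _ F _ _ _ _ _ _ _ _ _ _ _ _ _ _ _ Ha Hb Hx Hy Pz PM); lia.
Qed.

(** If the zero run behind [q] has room for a block of diameter [v - u], that block is legal after
    [[u, v]] and must be longer than the interval from [z] to the end. *)
Lemma lo_window n k w O q z I c s u t v : late_ones n k w O q z I ->
  pos w c s u -> pos w c t v -> s + n <= t -> v <= q ->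
  z + u <= q + 1 + v \/ 6 * n + 2 + k + u < z + v.
Proof.
  intros L Hu Hv H1 H2.
  destruct (le_lt_dec (z + u) (q + 1 + v)) as [H3|H3]; [now left|right].
  pose proof (pos_same _ _ _ _ _ _ Hu Hv).
  pose proof (pos_range _ _ _ _ (lo_q _ _ _ _ _ _ _ L)).
  pose proof (lo_zero _ _ _ _ _ _ _ (q + 1) L ltac:(lia) ltac:(lia)) as P1.
  pose proof (lo_zero _ _ _ _ _ _ _ (q + 1 + v - u) L ltac:(lia) ltac:(lia)) as P2.
  pose proof (lo_before_z2 _ _ _ _ _ _ _ _ _ _ _ _ _ _ _ _ _ L Hu Hv P1 P2); lia.
Qed.

(* A colour class with more than [n] letters before [q] has diameter below [2 n],
   while [n + 1] consecutive letters of it span at least the zero run after [q]. *)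
Lemma lo_span n k w O q z I c b : late_ones n k w O q z I ->
  n + 1 <= b -> (exists y, pos w c b y /\ y < q) ->
  z + b <= q + 3 * n + 1 \/ 3 * n + 2 + k + b < z.
Proof.
  intros L Hb (y & Py & Hy).
  assert (Hc : b <= cn w c y) by (destruct Py as (_ & _ & ->); lia).
  destruct (pos_ex w c 1 y) as (x & Px & _); [lia|].
  destruct (pos_ex w c (n + 1) y) as (m & Pm & _); [lia|].
  pose proof (lo_before_q _ _ _ _ _ _ _ _ _ _ _ _ L Px Py ltac:(lia) Hy).
  pose proof (pos_same _ _ _ _ _ _ Pm Py); pose proof (pos_same _ _ _ _ _ _ Px Pm).
  destruct (lo_window _ _ _ _ _ _ _ _ _ _ _ _ L Px Pm); lia.
Qed.

Lemma lo_zrange n k w O q z I : late_ones n k w O q z I ->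
  z + n <= 6 * n + 2 + k /\ 1 <= O <= q /\ q < z.
Proof.
  intros [F Pq Pz PM ? ? ?].
  pose proof (pos_same _ _ _ _ _ _ Pz PM); pose proof (pos_range _ _ _ _ Pq); lia.
Qed.

(** A longer zero run splits into two blocks of [n + 1] zeros, the second one legal, while the
    interval from [z] to the end has diameter at least [n]. *)
Lemma lo_rho n k w O q z I : late_ones n k w O q z I -> z <= q + 2 * n + 2.
Proof.
  intros L; pose proof (lo_zrange _ _ _ _ _ _ _ L).
  destruct (le_lt_dec z (q + 2 * n + 2)) as [|H1]; [assumption|exfalso].
  pose proof (lo_zero _ _ _ _ _ _ _ (q + 1) L ltac:(lia) ltac:(lia)) as P1.
  pose proof (lo_zero _ _ _ _ _ _ _ (q + 1 + n) L ltac:(lia) ltac:(lia)) as P2.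
  pose proof (lo_zero _ _ _ _ _ _ _ (q + 2 + n) L ltac:(lia) ltac:(lia)) as P3.
  pose proof (lo_zero _ _ _ _ _ _ _ (q + 2 + 2 * n) L ltac:(lia) ltac:(lia)) as P4.
  pose proof (lo_before_z2 _ _ _ _ _ _ _ _ _ _ _ _ _ _ _ _ _ L P1 P2 P3 P4); lia.
Qed.

(** [lo_span] limits the ones and the zeros before [q]; for so large a [z] the two limits do not add
    up to the length of the prefix. *)
Lemma lo_far n k w O q z I : late_ones n k w O q z I ->
  n + 1 <= 2 * k -> 4 * n + 3 + k <= z -> False.
Proof.
  intros L Hk Hz.
  pose proof (lo_zrange _ _ _ _ _ _ _ L) as Hr.
  pose proof (lo_qle _ _ _ _ _ _ _ L) as Hq.
  pose proof (lo_rho _ _ _ _ _ _ _ L) as Hrho.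
  assert (S1 : n + 2 <= O -> z + O <= q + 3 * n + 2 \/ 3 * n + 1 + k + O < z).
  { intros HO.
    assert (HC : cn w true q = O) by apply (lo_q _ _ _ _ _ _ _ L).
    destruct (pos_ex w true (O - 1) q) as (y & Py & _); [lia|].
    pose proof (pos_same _ _ _ _ _ _ Py (lo_q _ _ _ _ _ _ _ L)).
    destruct (lo_span _ _ _ _ _ _ _ true (O - 1) L); [lia|exists y; split; [exact Py|lia]|..]; lia. }
  assert (S0 : n + 1 <= q - O -> z + (q - O) <= q + 3 * n + 1 \/ 3 * n + 2 + k + (q - O) < z).
  { intros HO.
    assert (HC : cn w true q = O) by apply (lo_q _ _ _ _ _ _ _ L).
    pose proof (cn_sum w q).
    destruct (pos_ex w false (q - O) q) as (y & Py & Hy); [lia|].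
    pose proof (pos_opp _ _ _ _ _ (lo_q _ _ _ _ _ _ _ L) Py).
    apply (lo_span _ _ _ _ _ _ _ false (q - O) L); [lia|exists y; split; [exact Py|lia]]. }
  lia.
Qed.

(** Were [x + 2n] one of the zeros between [q] and [z], the interval [[x, x + 2n]] would be good,
    since it has at most [n] ones. But a wide interval before [z] is longer than
    [6n + 2 + k - z >= 2n]. *)
Lemma lo_zero_gap n k w O q z I t x : late_ones n k w O q z I ->
  z <= 4 * n + 2 + k -> pos w false t x -> O + t <= x + n ->
  x + 2 * n <= q \/ z <= x + 2 * n.
Proof.
  intros L Hz Px H.
  destruct (le_lt_dec (x + 2 * n) q) as [|H1]; [now left|right].
  destruct (le_lt_dec z (x + 2 * n)) as [|H2]; [assumption|exfalso].
  pose proof (lo_zero _ _ _ _ _ _ _ (x + 2 * n) L ltac:(lia) ltac:(lia)) as Py.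
  pose proof (lo_before_z _ _ _ _ _ _ _ _ _ _ _ _ L Px Py); lia.
Qed.

(** By [lo_zero_gap] no zero lies strictly between [q - 2n] and [z - 2n]; if some zero comes
    earlier, the zeros before [q] span less than [2n]. The remaining letters up to [q] then include
    more than [n + 1] ones. *)
Lemma lo_few_ones n k w O q z I : late_ones n k w O q z I ->
  3 <= n -> 2 <= k -> 3 * n + 3 + k <= z -> z <= 4 * n + 2 + k ->
  O <= n \/ (O = n + 1 /\ exists o1, pos w true 1 o1 /\ 6 * n + 2 + k + o1 < z + q) ->
  False.
Proof.
  intros L Hn Hk Hz1 Hz2 HO.
  pose proof (lo_zrange _ _ _ _ _ _ _ L); pose proof (lo_qle _ _ _ _ _ _ _ L).
  pose proof (lo_rho _ _ _ _ _ _ _ L).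
  pose proof (lo_q _ _ _ _ _ _ _ L) as Pq.
  assert (HC : cn w true q = O) by apply Pq.
  pose proof (cn_sum w q); pose proof (cn_sum w (q - 2 * n)).
  assert (HO' : forall t x, pos w false t x -> q < x + 2 * n -> O + t <= x + n).
  { intros t x Px Hx.
    pose proof (pos_range _ _ _ _ Px).
    destruct HO as [HO|(HO & o1 & P1 & G1)]; [lia|].
    pose proof (pos_opp _ _ _ _ _ P1 Px); lia. }
  assert (H2q : O = n + 1 -> 2 * n + 2 <= q).
  { intros E; destruct HO as [HO|(HO & o1 & P1 & G1)]; [lia|].
    pose proof (pos_range _ _ _ _ P1); lia. }
  destruct (pos_ex w false (cn w false (q - 2 * n) + 1) q) as (x2 & P2 & Hx2).
  { pose proof (cn_lip w false (q - 2 * n) q ltac:(lia)).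
    pose proof (cn_lip w false 0 (q - 2 * n) ltac:(lia)); simpl in *; lia. }
  pose proof (pos_cn _ _ _ _ (q - 2 * n) P2).
  destruct (lo_zero_gap _ _ _ _ _ _ _ _ _ L Hz2 P2) as [|G]; [apply (HO' _ _ P2); lia|lia|].
  destruct (pos_ex w false (q - O) q) as (y & Py & Hy); [lia|].
  pose proof (pos_opp _ _ _ _ _ Pq Py).
  pose proof (pos_same _ _ _ _ _ _ P2 Py).
  destruct (le_lt_dec (cn w false (q - 2 * n)) 0) as [G0|G0]; [lia|].
  destruct (pos_ex w false (cn w false (q - 2 * n)) (q - 2 * n)) as (x1 & P1 & Hx1); [lia|].
  destruct (pos_ex w false 1 (q - 2 * n)) as (x0 & P0 & Hx0); [lia|].
  pose proof (pos_same _ _ _ _ _ _ P0 P1).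
  pose proof (pos_range _ _ _ _ P1).
  pose proof (lo_before_q _ _ _ _ _ _ _ _ _ _ _ _ L P0 Py); lia.
Qed.

Lemma lo_wide_ones n k w O q z I o1 : late_ones n k w O q z I ->
  3 <= n -> n + 1 <= 2 * k -> 3 * n + 3 + k <= z -> z <= 4 * n + 2 + k ->
  n + 2 <= O -> pos w true 1 o1 -> 6 * n + 2 + k + o1 < z + q -> False.
Proof.
  intros L Hn Hk Hz1 Hz2 HO P1 Ho1.
  pose proof (lo_zrange _ _ _ _ _ _ _ L); pose proof (lo_qle _ _ _ _ _ _ _ L).
  pose proof (lo_q _ _ _ _ _ _ _ L) as Pq.
  pose proof (lo_z _ _ _ _ _ _ _ L) as Pz.
  assert (HC : cn w true q = O) by apply Pq.
  destruct (pos_ex w true (O - 1) q) as (r & Pr & _); [lia|].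
  destruct (pos_ex w true (O - 1 - n) q) as (p & Pp & _); [lia|].
  pose proof (pos_le _ _ _ _ _ _ Pr Pq ltac:(lia)).
  pose proof (pos_le _ _ _ _ _ _ Pp Pr ltac:(lia)).
  pose proof (pos_le _ _ _ _ _ _ P1 Pp ltac:(lia)); pose proof (pos_range _ _ _ _ Pr).
  pose proof (pos_range _ _ _ _ P1); pose proof (pos_range _ _ _ _ Pp).
  pose proof (lo_before_q _ _ _ _ _ _ _ _ _ _ _ _ L P1 Pr ltac:(lia) ltac:(lia)) as Hsp.
  (* Otherwise the zeros directly behind [r], interrupted only by the one at [q], give a second set
     of diameter at most [r - p + 1]. *)
  assert (Hw : z + p <= 2 * r + 2).
  { destruct (le_lt_dec (z + p) (2 * r + 2)) as [|G]; [assumption|exfalso].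
    pose proof (lo_zero _ _ _ _ _ _ _ (z - 1) L ltac:(lia) ltac:(lia)) as (_ & _ & Cz).
    destruct (pos_ex w false (r + 2 - O) (z - 1)) as (a & Pa & Ha); [lia|].
    destruct (pos_ex w false (r + 2 - O + (r - p)) (z - 1)) as (b & Pb & Hb); [lia|].
    assert (Hra : r < a) by (pose proof (pos_opp _ _ _ _ _ Pr Pa); lia).
    assert (Hbz : b <= r + (r - p) + 2) by (pose proof (pos_opp _ _ _ _ _ Pz Pb); lia).
    pose proof (pos_le _ _ _ _ _ _ Pa Pb ltac:(lia)).
    assert (6 * n + 2 + k + a < z + b); [|lia].
    apply (lo_before_z2 _ _ _ _ _ _ _ _ _ _ _ _ _ _ _ _ _ L Pp Pr Pa Pb); lia. }
  destruct (le_lt_dec z (4 * n + 1 + k)) as [Hz3|Hz3].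
  - assert (Hx : forall t x, pos w false t x -> p < x -> x + 2 * n + 2 <= z ->
        6 * n + 1 + k + x < z + q).
    { intros t x Px Hpx Hxz; pose proof (pos_opp _ _ _ _ _ Pp Px).
      destruct (le_lt_dec (x + 2 * n + 1) q) as [Hc|Hc].
      - pose proof (lo_zero _ _ _ _ _ _ _ (q + 1) L ltac:(lia) ltac:(lia)) as Py.
        pose proof (lo_before_z _ _ _ _ _ _ _ _ _ _ _ _ L Px Py); lia.
      - pose proof (lo_zero _ _ _ _ _ _ _ (x + 2 * n + 1) L ltac:(lia) ltac:(lia)) as Py.
        pose proof (lo_before_z _ _ _ _ _ _ _ _ _ _ _ _ L Px Py); lia. }
    destruct (le_lt_dec (r + 2 * n + 2) z) as [Hr|Hr].
    + destruct (le_lt_dec (r - p) n) as [G|G]; [lia|].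
      assert (Cr : cn w false r = r - (O - 1)).
      { pose proof (cn_sum w r); destruct Pr as (_ & _ & Er); lia. }
      destruct (pos_ex w false (r - (O - 1)) r) as (x & Px & Hxr); [lia|].
      pose proof (pos_opp _ _ _ _ _ Pp Px); pose proof (pos_opp _ _ _ _ _ Pr Px).
      pose proof (Hx _ _ Px); lia.
    + pose proof (cn_sum w (z - 2 * n - 2)).
      pose proof (pos_cn _ _ _ _ (z - 2 * n - 2) Pr).
      destruct (le_lt_dec (cn w false (z - 2 * n - 2)) (p - (O - 1 - n))) as [G|G]; [lia|].
      destruct (pos_ex w false (cn w false (z - 2 * n - 2)) (z - 2 * n - 2))
        as (x & Px & Hxr); [lia|].
      pose proof (pos_opp _ _ _ _ _ Pp Px).
      pose proof (Hx _ _ Px); lia.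
  (* Here [z = 4n + 2 + k], and the zeros before [q] contradict [lo_span]. *)
  - pose proof (cn_sum w q).
    destruct (pos_ex w false (q - O) q) as (y & Py & Hy); [lia|].
    pose proof (pos_opp _ _ _ _ _ Pq Py).
    destruct (lo_span _ _ _ _ _ _ _ false (q - O) L);
      [lia|exists y; split; [exact Py|lia]|lia|lia].
Qed.

(** * Prefixes whose ones span less than [2n] *)

Lemma init_zero w o1 i : pos w true 1 o1 -> 1 <= i -> i < o1 -> pos w false i i.
Proof.
  intros P Hi Ho.
  destruct (pos_here w i Hi) as [Q|Q].
  - pose proof (pos_same _ _ _ _ _ _ P Q); pose proof (pos_range _ _ _ _ Q); lia.
  - pose proof (pos_cn _ _ _ _ i P); pose proof (cn_sum w i).
    replace i with (cn w false i) at 1 by lia; exact Q.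
Qed.

(** This is the configuration that [lo_far], [lo_few_ones] and [lo_wide_ones] leave open. *)
Record narrow n k w O q z I o1 : Prop := Narrow {
  na_lo : late_ones n k w O q z I;
  na_n : 3 <= n;
  na_k : 2 * n <= 3 * k + 2 /\ n + 1 <= 2 * k /\ k <= n;
  na_z : 3 * n + 3 + k <= z <= 4 * n + 2 + k;
  na_O : n + 1 <= O;
  na_o1 : pos w true 1 o1;
  na_span : q < o1 + 2 * n;
  na_q : q <= 3 * n
}.

Lemma na_basic n k w O q z I o1 : narrow n k w O q z I o1 ->
  1 <= O /\ O <= q /\ q < z /\ 1 <= o1 /\ o1 + O <= q + 1.
Proof.
  intros [L ? ? ? ? P1 ? ?].
  pose proof (lo_zrange _ _ _ _ _ _ _ L).
  pose proof (pos_same _ _ _ _ _ _ P1 (lo_q _ _ _ _ _ _ _ L)).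
  pose proof (pos_range _ _ _ _ P1); lia.
Qed.

Lemma na_wide_zero n k w O q z I o1 : narrow n k w O q z I o1 -> 2 <= o1 ->
  exists s x y, pos w false s x /\ pos w false (s + n) y /\
    pos w false (s + n + 1) (y + 1) /\ y = x + O + n /\
    (y = q + 1 /\ s + n + O = q + 1 \/ q < n + O /\ y = n + 1 + O /\ s = 1) /\
    6 * n + 2 + k < z + O + n.
Proof.
  intros N Ho; pose proof (na_basic _ _ _ _ _ _ _ _ N).
  destruct N as [L ? ? ? ? P1 ? ?].
  destruct (le_lt_dec (n + O) q) as [G|G].
  - pose proof (init_zero _ _ (q - O - n + 1) P1 ltac:(lia) ltac:(lia)) as Px.
    pose proof (lo_zero _ _ _ _ _ _ _ (q + 1) L ltac:(lia) ltac:(lia)) as Py.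
    pose proof (lo_zero _ _ _ _ _ _ _ (q + 2) L ltac:(lia) ltac:(lia)) as Pz.
    pose proof (lo_before_z _ _ _ _ _ _ _ _ _ _ _ _ L Px Py).
    exists (q - O - n + 1), (q - O - n + 1), (q + 1).
    replace (q - O - n + 1 + n + 1) with (q + 2 - O) by lia.
    replace (q - O - n + 1 + n) with (q + 1 - O) by lia.
    replace (q + 1 + 1) with (q + 2) by lia.
    splits.
  - pose proof (init_zero _ _ 1 P1 ltac:(lia) ltac:(lia)) as Px.
    pose proof (lo_zero _ _ _ _ _ _ _ (n + 1 + O) L ltac:(lia) ltac:(lia)) as Py.
    pose proof (lo_zero _ _ _ _ _ _ _ (n + 2 + O) L ltac:(lia) ltac:(lia)) as Pz.
    pose proof (lo_before_z _ _ _ _ _ _ _ _ _ _ _ _ L Px Py).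
    exists 1, 1, (n + 1 + O).
    replace (1 + n + 1) with (n + 2 + O - O) by lia.
    replace (1 + n) with (n + 1 + O - O) at 1 by lia.
    replace (n + 1 + O + 1) with (n + 2 + O) by lia.
    splits.
Qed.

(** At most [n] ones lie between [x] and [q], and [x + 2n] is beyond [q] by the narrow span, so
    [lo_zero_gap] applies. *)
Lemma na_late_zero n k w O q z I o1 ow t x : narrow n k w O q z I o1 ->
  pos w true (O - n) ow -> pos w false t x -> ow < x -> z <= x + 2 * n.
Proof.
  intros N Pw Px Hx; destruct N as [L ? ? ? ? P1 ? ?].
  pose proof (pos_opp _ _ _ _ _ Pw Px); pose proof (pos_same _ _ _ _ _ _ P1 Pw).
  destruct (lo_zero_gap _ _ _ _ _ _ _ _ _ L ltac:(lia) Px); lia.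
Qed.

(* A short window of [n + 1] ones: [q - n - ow] counts the zeros of the last
   window, and the first window is used only when it avoids all of them. *)
Lemma na_window n k w O q z I o1 : narrow n k w O q z I o1 ->
  2 <= o1 /\
  exists ow u v s t, pos w true (O - n) ow /\ pos w true s u /\ pos w true t v /\
    s + n <= t /\ v <= q /\ u + n <= v /\ v < u + 2 * n /\ z + u <= q + 1 + v /\
    ow + n <= q /\ q + O <= ow + 3 * n /\ o1 + O <= ow + n + 1 /\
    (u = ow /\ v = q /\ (q = ow + n \/ z + q <= ow + 5 * n + 1) \/
     q <= n + O /\ 2 * v + O <= 2 * u + 4 * n /\ v + ow <= u + q).
Proof.
  intros N; pose proof (na_basic _ _ _ _ _ _ _ _ N) as NB.
  assert (NN := N); destruct N as [L Hn Hk Hz HO P1 Hs Hq].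
  pose proof (lo_q _ _ _ _ _ _ _ L) as Pq.
  assert (HC : cn w true q = O) by apply Pq.
  destruct (pos_ex w true (O - n) q) as (ow & Pw & _); [lia|].
  destruct (pos_ex w true (n + 1) q) as (on & Pn & _); [lia|].
  assert (B1 : ow + n <= q) by (pose proof (pos_same _ _ _ _ _ _ Pw Pq); lia).
  assert (B2 : o1 + O <= ow + n + 1) by (pose proof (pos_same _ _ _ _ _ _ P1 Pw); lia).
  assert (B3 : o1 + n <= on /\ on <= q).
  { pose proof (pos_same _ _ _ _ _ _ P1 Pn); pose proof (pos_same _ _ _ _ _ _ Pn Pq); lia. }
  assert (W1 : z + ow <= q + 1 + q).
  { destruct (lo_window _ _ _ _ _ _ _ _ _ _ _ _ L Pw Pq); lia. }
  assert (W0 : z + o1 <= q + 1 + on).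
  { destruct (lo_window _ _ _ _ _ _ _ _ _ _ _ _ L P1 Pn); lia. }
  (* Unless the last window consists of consecutive ones, the first zero [x] behind [ow] bounds [z]
     through [na_late_zero]. *)
  assert (Cases : q = ow + n \/
    (exists x, z <= x + 2 * n /\ pos w false (ow - (O - n) + 1) x /\ x <= q /\
       (x < on /\ x + O <= ow + 2 * n + 1 \/ on + O <= ow + 2 * n + 1))).
  { destruct (le_lt_dec q (ow + n)) as [G|G]; [left; lia|right].
    pose proof (cn_sum w q).
    destruct (pos_ex w false (ow - (O - n) + 1) q) as (x & Px & Hxq); [lia|].
    exists x; pose proof (pos_opp _ _ _ _ _ Pw Px); pose proof (pos_opp _ _ _ _ _ Pn Px).
    splits. apply (na_late_zero _ _ _ _ _ _ _ _ _ _ _ NN Pw Px); lia. }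
  assert (Ho1 : 2 <= o1).
  { destruct (le_lt_dec 2 o1) as [|G]; [assumption|exfalso].
    destruct Cases as [C|(x & Hx & Px & Hxq & C)]; lia. }
  split; [exact Ho1|].
  destruct Cases as [C|(x & Hx & Px & Hxq & C)].
  { exists ow, ow, q, (O - n), O; splits. }
  destruct (le_lt_dec (n + O + 1) q) as [G|G].
  - exists ow, ow, q, (O - n), O.
    pose proof (cn_sum w q).
    destruct (pos_ex w false (q - O) q) as (y & Py & Hy); [lia|].
    pose proof (init_zero _ _ 1 P1 ltac:(lia) ltac:(lia)) as Pi.
    assert (y < 1 + 2 * n).
    { pose proof (pos_opp _ _ _ _ _ Pq Py).
      apply (lo_before_q _ _ _ _ _ _ _ _ _ _ _ _ L Pi Py); lia. }
    pose proof (pos_same _ _ _ _ _ _ Px Py).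
    splits.
  - destruct C as [C|C]; [exists ow, ow, q, (O - n), O; splits|].
    destruct (le_lt_dec (on + ow) (q + o1)) as [G1|G1].
    + exists ow, o1, on, 1, (n + 1); splits.
    + exists ow, ow, q, (O - n), O; splits.
Qed.

(** With only [n + 1] ones behind [q], zeros abound. The wide zero interval bounds the last zero
    [lz] from above; the window [[u, v]], followed by two zero blocks, pushes it beyond that
    bound. *)
Lemma na_exact n k w O q z I o1 : narrow n k w O q z I o1 -> I = O + n + 1 -> False.
Proof.
  intros N HI; pose proof (na_basic _ _ _ _ _ _ _ _ N) as NB.
  destruct (na_window _ _ _ _ _ _ _ _ N)
    as (Ho1 & ow & u & v & s & t & Pw & Pu & Pv & H1 & H2 & H3 & H4 & H5 & H6 & H7 & H8 & H9).
  destruct (na_wide_zero _ _ _ _ _ _ _ _ N Ho1)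
    as (i & x & y & Px & Py & Py1 & E1 & E2 & E3).
  destruct N as [L Hn Hk Hz HO P1 Hs Hq].
  pose proof (lo_free _ _ _ _ _ _ _ L) as F.
  pose proof (lo_M _ _ _ _ _ _ _ L) as PM.
  pose proof (lo_I _ _ _ _ _ _ _ L).
  set (M := 6 * n + 2 + k) in *.
  assert (CM : cn w false M = M - I) by (pose proof (cn_sum w M); destruct PM as (_ & _ & E); lia).
  assert (M = 6 * n + 2 + k) by reflexivity; clearbody M.
  pose proof (pos_range _ _ _ _ Pu).
  destruct (pos_ex w false (M - I) M) as (lz & Pl & Hl); [lia|].
  assert (Q1 : lz + x < y + 1 + y).
  { pose proof (free1 _ _ _ F _ _ _ _ _ _ _ _ _ _ Px Py Py1 Pl); lia. }
  pose proof (lo_zero _ _ _ _ _ _ _ (q + 1) L ltac:(lia) ltac:(lia)) as Pa.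
  destruct (pos_ex w false (q + 1 - O + (v - u)) M) as (b & Pb & Hb); [lia|].
  assert (B1 : q + 1 + (v - u) <= b) by (pose proof (pos_same _ _ _ _ _ _ Pa Pb); lia).
  assert (B2 : b + (M - I) <= lz + (q + 1 - O + (v - u))).
  { pose proof (pos_same _ _ _ _ _ _ Pb Pl); lia. }
  destruct (le_lt_dec (q + 2 - O + (v - u) + n) (M - I)) as [G|G]; [|lia].
  destruct (pos_ex w false (q + 2 - O + (v - u)) M) as (a3 & P3 & H3'); [lia|].
  assert (B3 : b < a3) by (pose proof (pos_same _ _ _ _ _ _ Pb P3); lia).
  assert (B4 : a3 + (M - I) <= lz + (q + 2 - O + (v - u))).
  { pose proof (pos_same _ _ _ _ _ _ P3 Pl); lia. }
  pose proof (free2 _ _ _ F _ _ _ _ _ _ _ _ _ _ _ _ _ _ _ Pu Pv Pa Pb P3 Pl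
    ltac:(lia) ltac:(lia) ltac:(lia) ltac:(lia) ltac:(lia) ltac:(lia) ltac:(lia)) as Q2.
  clear - Q1 Q2 B1 B2 B3 B4 E1 E2 E3 Hk Hn Hz HO Hq NB HI H H0 H3 H4 H5 H6 H7 H8 H9 Hs.
  lia.
Qed.

(** A one [o] of rank at most [O - n + 1] with [o + 2n <= z] makes [[o, z]] wide, hence longer than
    the interval from [z2] to the end. The cases describe how [z - 2n] lies relative to [ow] and the
    next one. *)
Lemma na_ones_end n k w O q z I o1 z2 ow : narrow n k w O q z I o1 ->
  O + n + 2 <= I -> pos w true (O + 2) z2 -> pos w true (O - n) ow -> 2 <= o1 ->
  6 * n + 3 + k + ow < z2 + z /\ ow + 2 * n < z \/
  6 * n + 2 + k <= z2 + 2 * n /\ ow + 2 * n <= z /\ z <= ow + 2 * n + 1 \/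
  z < ow + 2 * n /\ exists r o, r < O - n /\ r + o1 <= o + 1 /\ o + 2 * n <= z /\
    6 * n + 2 + k + o < z2 + z /\ z + O <= ow + 3 * n + r.
Proof.
  intros N HI P2 Pw Ho1; pose proof (na_basic _ _ _ _ _ _ _ _ N) as NB.
  destruct (na_wide_zero _ _ _ _ _ _ _ _ N Ho1) as (_ & _ & _ & _ & _ & _ & _ & _ & E3).
  assert (NN := N); destruct N as [L Hn Hk Hz HO P1 Hs Hq].
  pose proof (lo_free _ _ _ _ _ _ _ L) as F.
  pose proof (lo_M _ _ _ _ _ _ _ L) as PM.
  pose proof (lo_q _ _ _ _ _ _ _ L) as Pq.
  pose proof (lo_z _ _ _ _ _ _ _ L) as Pz.
  assert (Z2 : z < z2) by (pose proof (pos_same _ _ _ _ _ _ Pz P2); lia).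
  assert (LW : forall r o, pos w true r o -> 1 <= r -> r <= O - n + 1 -> o + 2 * n <= z ->
     6 * n + 2 + k + o < z2 + z).
  { intros r o Po Hr1 Hr2 Hoz.
    pose proof (free1 _ _ _ F _ _ _ _ _ _ _ _ _ _ Po Pz P2 PM); lia. }
  assert (HC : cn w true q = O) by apply Pq.
  destruct (pos_ex w true (O - n + 1) q) as (ow1 & Pw1 & _); [lia|].
  assert (B1 : ow < ow1) by (pose proof (pos_same _ _ _ _ _ _ Pw Pw1); lia).
  destruct (le_lt_dec (ow1 + 2 * n) z) as [G|G].
  { left; pose proof (LW _ _ Pw1); lia. }
  right.
  pose proof (pos_cn _ _ _ _ (z - 2 * n) P1) as C1.
  pose proof (pos_cn _ _ _ _ (z - 2 * n) Pw) as Cw.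
  pose proof (pos_cn _ _ _ _ (z - 2 * n) Pw1) as Cw1.
  destruct (pos_ex w true (cn w true (z - 2 * n)) (z - 2 * n)) as (o & Po & Ho); [lia|].
  destruct (le_lt_dec (ow + 2 * n) z) as [G1|G1].
  - left.
    assert (Hzw : z <= ow + 2 * n + 1).
    { destruct (le_lt_dec z (ow + 2 * n + 1)) as [|G2]; [assumption|exfalso].
      destruct (pos_here w (ow + 1)) as [Q|Q]; [lia|..].
      - pose proof (pos_same _ _ _ _ _ _ Pw Q); pose proof (pos_same _ _ _ _ _ _ Pw1 Q); lia.
      - pose proof (na_late_zero _ _ _ _ _ _ _ _ _ _ _ NN Pw Q); lia. }
    pose proof (LW _ _ Pw); lia.
  - right; split; [lia|]; exists (cn w true (z - 2 * n)), o.
    pose proof (LW _ _ Po) as Q.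
    assert (r_o : cn w true (z - 2 * n) + o1 <= o + 1).
    { pose proof (pos_same _ _ _ _ _ _ P1 Po); lia. }
    splits.
    pose proof (cn_lip w false (z - 2 * n) ow ltac:(lia)).
    pose proof (cn_sum w (z - 2 * n)); pose proof (cn_sum w ow).
    destruct Pw as (_ & _ & Ew); lia.
Qed.

Lemma zero_between w O z z2 p : pos w true (O + 1) z -> pos w true (O + 2) z2 ->
  z < p -> p < z2 -> pos w false (p - O - 1) p.
Proof.
  intros Pz P2 H1 H2.
  pose proof (pos_cn _ _ _ _ p Pz); pose proof (pos_cn _ _ _ _ p P2).
  pose proof (cn_sum w p).
  destruct (pos_here w p) as [P|P]; [lia|..].
  - pose proof (pos_same _ _ _ _ _ _ P Pz); pose proof (pos_same _ _ _ _ _ _ P P2); lia.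
  - replace (p - O - 1) with (cn w false p) by lia; exact P.
Qed.

(* Between [q] and the second one [z2] after it there is a single one, so the
   zeros there provide the second set, and possibly the third. *)
Lemma na_zero_block n k w O q z I o1 z2 u v s t : narrow n k w O q z I o1 ->
  O + n + 2 <= I -> pos w true (O + 2) z2 ->
  pos w true s u -> pos w true t v -> s + n <= t -> v <= q -> u + n <= v ->
  v < u + 2 * n -> z + u <= q + 1 + v ->
  z2 + u <= q + 2 + v \/
  6 * n + 2 + k <= z2 + (v - u) /\
  (z2 <= q + 2 * n + 4 \/
   z2 + n = 6 * n + 2 + k /\ z2 <= q + 4 + 2 * (v - u) /\
   (z2 <= z + 1 + (v - u) \/ u + n + 1 <= v)).
Proof.
  intros N HI P2 Pu Pv G1 G2 G3 G4 G5; pose proof (na_basic _ _ _ _ _ _ _ _ N) as NB.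
  destruct N as [L Hn Hk Hz HO P1 Hs Hq].
  pose proof (lo_free _ _ _ _ _ _ _ L) as F.
  pose proof (lo_M _ _ _ _ _ _ _ L) as PM.
  pose proof (lo_z _ _ _ _ _ _ _ L) as Pz.
  assert (Z2 : z < z2) by (pose proof (pos_same _ _ _ _ _ _ Pz P2); lia).
  assert (Z3 : z2 + n <= 6 * n + 2 + k) by (pose proof (pos_same _ _ _ _ _ _ P2 PM); lia).
  destruct (le_lt_dec (z2 + u) (q + 2 + v)) as [G|G]; [now left|right].
  (* This finds the zero [j] ranks after the first zero behind [q]; passing [z] costs one
     position. *)
  assert (Ex : forall j, q + 1 - O + j <= z2 - 2 - O ->
     exists b, pos w false (q + 1 - O + j) b /\ b < z2 /\ q + 1 + j <= b /\ b <= q + 2 + j /\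
       (b < z /\ b = q + 1 + j \/ z < b /\ b = q + 2 + j)).
  { intros j Hj.
    destruct (le_lt_dec z (q + 1 + j)) as [Hc|Hc].
    - exists (q + 2 + j).
      pose proof (zero_between _ _ _ _ (q + 2 + j) Pz P2 ltac:(lia) ltac:(lia)) as Q.
      replace (q + 1 - O + j) with (q + 2 + j - O - 1) by lia; splits.
    - exists (q + 1 + j).
      pose proof (lo_zero _ _ _ _ _ _ _ (q + 1 + j) L ltac:(lia) ltac:(lia)) as Q.
      replace (q + 1 - O + j) with (q + 1 + j - O) by lia; splits. }
  destruct (Ex 0) as (a & Pa & Ha); [lia|].
  destruct (Ex (v - u)) as (b & Pb & Hb); [lia|].
  assert (Q1 : 6 * n + 2 + k <= z2 + (v - u)).
  { pose proof (free2 _ _ _ F _ _ _ _ _ _ _ _ _ _ _ _ _ _ _ Pu Pv Pa Pb P2 PM); lia. }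
  split; [exact Q1|].
  destruct (le_lt_dec z2 (q + 2 * n + 4)) as [K|K]; [now left|right].
  (* Two blocks of zeros fit between [q] and [z2], the second of diameter at most [n + 1]. *)
  assert (Q2 : z2 + n = 6 * n + 2 + k).
  { destruct (Ex n) as (b1 & Pb1 & Hb1); [lia|].
    destruct (Ex (n + 1)) as (a2 & Pa2 & Ha2); [lia|].
    destruct (le_lt_dec z (q + n + 1)) as [Hc|Hc].
    - destruct (Ex (2 * n + 2)) as (b2 & Pb2 & Hb2); [lia|].
      pose proof (free2 _ _ _ F _ _ _ _ _ _ _ _ _ _ _ _ _ _ _ Pa Pb1 Pa2 Pb2 P2 PM); lia.
    - destruct (Ex (2 * n + 1)) as (b2 & Pb2 & Hb2); [lia|].
      pose proof (free2 _ _ _ F _ _ _ _ _ _ _ _ _ _ _ _ _ _ _ Pa Pb1 Pa2 Pb2 P2 PM); lia. }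
  split; [exact Q2|]; split.
  - destruct (le_lt_dec (z2 - q - 3) (v - u + n)) as [K1|K1]; [lia|].
    destruct (Ex (v - u + 1)) as (a3 & Pa3 & Ha3); [lia|].
    destruct (Ex (z2 - q - 3)) as (b3 & Pb3 & Hb3); [lia|].
    pose proof (free2 _ _ _ F _ _ _ _ _ _ _ _ _ _ _ _ _ _ _ Pu Pv Pa Pb Pa3 Pb3); lia.
  - destruct (le_lt_dec z2 (z + 1 + (v - u))) as [K1|K1]; [now left|right].
    pose proof (zero_between _ _ _ _ (z + 1) Pz P2 ltac:(lia) ltac:(lia)) as Q3.
    pose proof (zero_between _ _ _ _ (z + 1 + (v - u)) Pz P2 ltac:(lia) ltac:(lia)) as Q4.
    pose proof (free2 _ _ _ F _ _ _ _ _ _ _ _ _ _ _ _ _ _ _ Pu Pv Q3 Q4 P2 PM); lia.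
Qed.

Lemma na_false n k w O q z I o1 : narrow n k w O q z I o1 -> False.
Proof.
  intros N.
  pose proof (lo_I _ _ _ _ _ _ _ (na_lo _ _ _ _ _ _ _ _ N)) as HI.
  destruct (Nat.eq_dec I (O + n + 1)) as [E|E]; [now apply (na_exact _ _ _ _ _ _ _ _ N)|].
  pose proof (na_basic _ _ _ _ _ _ _ _ N) as NB.
  destruct (pos_ex w true (O + 2) (6 * n + 2 + k)) as (z2 & P2 & _).
  { pose proof (lo_M _ _ _ _ _ _ _ (na_lo _ _ _ _ _ _ _ _ N)) as (_ & _ & E'); lia. }
  destruct (na_window _ _ _ _ _ _ _ _ N)
    as (Ho1 & ow & u & v & s & t & Pw & Pu & Pv & H1 & H2 & H3 & H4 & H5 & H6 & H7 & H8 & H9).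
  pose proof (na_zero_block _ _ _ _ _ _ _ _ _ _ _ _ _ N ltac:(lia) P2 Pu Pv H1 H2 H3 H4 H5) as V.
  pose proof (na_ones_end _ _ _ _ _ _ _ _ _ _ N ltac:(lia) P2 Pw Ho1) as R.
  destruct (na_wide_zero _ _ _ _ _ _ _ _ N Ho1) as (_ & _ & _ & _ & _ & _ & _ & _ & E3).
  destruct N as [_ Hn Hk Hz HO _ Hs Hq].
  clear P2 Pu Pv Pw E.
  remember (v - u) as D eqn:ED.
  assert (ED' : v = u + D) by lia; clear ED; subst v.
  destruct V as [V|V].
  - destruct R as [R|[R|(R & r & o & R')]].
    + destruct H9 as [(-> & H9 & [K|K])|H9]; lia.
    + destruct H9 as [(-> & H9 & [K|K])|H9]; lia.
    + destruct H9 as [(-> & H9 & [K|K])|H9]; lia.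
  - clear R; destruct H9 as [(-> & H9 & [K|K])|H9]; lia.
Qed.

(* The exceptional prefix contains two disjoint sets of diameter [n]. *)
Lemma prefix_good n w : 1 <= n ->
  (exists c s x t y, pos w c s x /\ pos w c t y /\ s + n <= t /\
     x + 2 * n <= y /\ y <= 3 * n + 1) \/
  (exists c c' s0 a t0 b s x t y, pos w c s0 a /\ pos w c t0 b /\ pos w c' s x /\
     pos w c' t y /\ s0 + n <= t0 /\ b < x /\ b + x <= y + a /\ s + n <= t /\
     y <= 3 * n + 1 /\ y <= x + n).
Proof.
  intros Hn; destruct (interval_good n w 1 (3 * n)) as [H|H]; [lia|lia|left|right].
  - destruct H as (c & s & x & t & y & Px & Py & H1 & H2 & H3 & H4).
    exists c, s, x, t, y; splits.
  - destruct H as (c & H1 & H2); change (cn w c (1 - 1)) with 0 in H1.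
    destruct (pos_ex w c 1 (1 + n)) as (a & Pa & Ha); [lia|].
    destruct (pos_ex w c (n + 1) (1 + n)) as (b & Pb & Hb); [lia|].
    replace (1 + 3 * n - n - 1) with (2 * n) in H2 by lia.
    destruct (pos_ex w (negb c) (cn w (negb c) (2 * n) + 1) (1 + 3 * n)) as (x & Px & Hx); [lia|].
    destruct (pos_ex w (negb c) (cn w (negb c) (2 * n) + 1 + n) (1 + 3 * n)) as (y & Py & Hy); [lia|].
    pose proof (pos_cn _ _ _ _ (2 * n) Px); pose proof (pos_range _ _ _ _ Pa).
    pose proof (pos_same _ _ _ _ _ _ Px Py); pose proof (pos_same _ _ _ _ _ _ Pa Pb).
    exists c, (negb c), 1, a, (n + 1), b, (cn w (negb c) (2 * n) + 1), x,
      (cn w (negb c) (2 * n) + 1 + n), y.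
    splits.
Qed.

Lemma not_free_many_ones n k w : 3 <= n -> 2 * n <= 3 * k + 2 -> n + 1 <= 2 * k -> k <= n ->
  free n (6 * n + 2 + k) w -> w (6 * n + 2 + k) = true ->
  cn w true (3 * n + 1) + n + 1 <= cn w true (6 * n + 2 + k) -> False.
Proof.
  intros Hn Hk1 Hk2 Hk3 F HM HI.
  assert (PM : pos w true (cn w true (6 * n + 2 + k)) (6 * n + 2 + k)) by (repeat split; auto; lia).
  destruct (pos_ex w true (cn w true (3 * n + 1) + 1) (6 * n + 2 + k)) as (z & Pz & _); [lia|].
  assert (Hz : 3 * n + 2 <= z) by (pose proof (pos_cn _ _ _ _ (3 * n + 1) Pz); lia).
  assert (Hz' : z + n <= 6 * n + 2 + k) by (pose proof (pos_same _ _ _ _ _ _ Pz PM); lia).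
  (* Without ones in the prefix, two blocks of [n + 1] zeros precede [z]. *)
  destruct (Nat.eq_dec (cn w true (3 * n + 1)) 0) as [E|E].
  { rewrite E in Pz; simpl in Pz.
    pose proof (init_zero _ _ 1 Pz ltac:(lia) ltac:(lia)) as P1.
    pose proof (init_zero _ _ (n + 1) Pz ltac:(lia) ltac:(lia)) as P2.
    pose proof (init_zero _ _ (n + 2) Pz ltac:(lia) ltac:(lia)) as P3.
    pose proof (init_zero _ _ (2 * n + 2) Pz ltac:(lia) ltac:(lia)) as P4.
    pose proof (free2 _ _ _ F _ _ _ _ _ _ _ _ _ _ _ _ _ _ _ P1 P2 P3 P4 Pz PM); lia. }
  destruct (pos_ex w true (cn w true (3 * n + 1)) (3 * n + 1)) as (q & Pq & Hq); [lia|].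
  set (O := cn w true (3 * n + 1)) in *.
  assert (L : late_ones n k w O q z (cn w true (6 * n + 2 + k))) by (split; auto; lia).
  assert (HO : O = cn w true (3 * n + 1)) by reflexivity; clearbody O.
  destruct (le_lt_dec (4 * n + 3 + k) z) as [G|G].
  { apply (lo_far _ _ _ _ _ _ _ L); lia. }
  (* A wide interval in the prefix cannot end before [q]; being longer than the interval from [z] to
     the end, it forces [z >= 3n + 3 + k]. *)
  assert (Q : exists c s x t y, pos w c s x /\ pos w c t y /\ s + n <= t /\ x + 2 * n <= y /\
    y <= 3 * n + 1 /\ 6 * n + 2 + k + x < z + y /\ q <= y).
  { destruct (prefix_good n w ltac:(lia)) as [H|H].
    - destruct H as (c & s & x & t & y & Px & Py & H1 & H2 & H3).
      exists c, s, x, t, y.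
      pose proof (lo_before_z _ _ _ _ _ _ _ _ _ _ _ _ L Px Py).
      pose proof (lo_before_q _ _ _ _ _ _ _ _ _ _ _ _ L Px Py).
      splits.
    - destruct H as (c & c' & s0 & a & t0 & b & s & x & t & y & Pa & Pb & Px & Py & H).
      pose proof (free2 _ _ _ F _ _ _ _ _ _ _ _ _ _ _ _ _ _ _ Pa Pb Px Py Pz PM); lia. }
  destruct Q as (c & s & x & t & y & Px & Py & H1 & H2 & H3 & H4 & H5).
  assert (Hx : 1 <= x) by apply Px.
  destruct (le_lt_dec O n) as [G1|G1].
  { apply (lo_few_ones _ _ _ _ _ _ _ L); auto; lia. }
  assert (EO : cn w true q = O) by apply Pq.
  destruct (pos_ex w true 1 q) as (o1 & P1 & _); [lia|].
  destruct (le_lt_dec (o1 + 2 * n) q) as [G2|G2].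
  - pose proof (lo_before_z _ _ _ _ _ _ _ _ _ _ _ _ L P1 Pq ltac:(lia) ltac:(lia) ltac:(lia)).
    destruct (Nat.eq_dec O (n + 1)) as [E1|E1].
    + apply (lo_few_ones _ _ _ _ _ _ _ L); auto; try lia.
      right; split; [exact E1|exists o1; split; [exact P1|lia]].
    + apply (lo_wide_ones _ _ _ _ _ _ _ o1 L); auto; lia.
  - apply (na_false n k w O q z (cn w true (6 * n + 2 + k)) o1); split; auto; try lia.
    (* For [q <= 3n]: a wide interval of ones would end at [q], against the narrow span, so the
       interval ends at a zero behind [q]. *)
    destruct c.
    + pose proof (pos_same _ _ _ _ _ _ P1 Px); pose proof (pos_range _ _ _ _ Px).
      pose proof (pos_cn _ _ _ _ (3 * n + 1) Py); pose proof (pos_same _ _ _ _ _ _ Py Pq); lia.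
    + pose proof (pos_opp _ _ _ _ _ Pq Py); lia.
Qed.

(** * Few letters of the last colour at the end *)

Lemma pos_oppc w c s x t y : pos w c s x -> pos w (negb c) t y ->
  (x < y /\ x < s + t /\ s + t <= y) \/ (y < x /\ y < s + t /\ s + t <= x).
Proof.
  destruct c; simpl; intros Hx Hy; [exact (pos_opp _ _ _ _ _ Hx Hy)|].
  pose proof (pos_opp _ _ _ _ _ Hy Hx); lia.
Qed.

(* The last letter is rare after position [3 n + 1], so the exceptional case of
   [interval_good] does not occur for a suffix of the word. *)
Lemma end_bound n k w x y : 1 <= n -> free n (6 * n + 2 + k) w ->
  cn w (w (6 * n + 2 + k)) (6 * n + 2 + k) <= cn w (w (6 * n + 2 + k)) (3 * n + 1) + n ->
  legal n w x y -> 5 * n + 2 + k + x <= 2 * y.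
Proof.
  intros Hn F HT Lg.
  assert (Hd : x + n <= y /\ 1 <= x).
  { destruct Lg as [(c & s & t & Px & Py & H) _].
    pose proof (pos_same _ _ _ _ _ _ Px Py); pose proof (pos_range _ _ _ _ Px); lia. }
  set (M := 6 * n + 2 + k) in *.
  assert (EM : M = 6 * n + 2 + k) by reflexivity; clearbody M.
  destruct (le_lt_dec M (y + 2 * n)) as [G|G]; [lia|].
  destruct (interval_good n w (y + 1) (M - y - 1)) as [H|H]; [lia|lia|..].
  - destruct H as (c & s & u & t & v & Pu & Pv & H1 & H2 & H3 & H4).
    assert (v + x < u + y); [|lia].
    apply (F x y Lg c); [exists s, t; auto|lia|lia].
  - destruct H as (c & _ & H2).
    replace (y + 1 + (M - y - 1)) with M in H2 by lia.
    pose proof (cn_lip w (negb c) (M - n - 1) (M - 1) ltac:(lia)).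
    pose proof (cn_lip w (negb c) (3 * n + 1) (M - n - 1) ltac:(lia)).
    assert (Em : w M = negb c).
    { apply Bool.eqb_prop; destruct (Bool.eqb (w M) (negb c)) eqn:E; [reflexivity|exfalso].
      assert (cn w (negb c) M = cn w (negb c) (M - 1)); [|lia].
      replace M with (S (M - 1)) at 1 by lia; simpl.
      replace (S (M - 1)) with M by lia; rewrite E; lia. }
    rewrite Em in HT; lia.
Qed.

(** The wide interval [[x, y]] with least right end, with colours exchanged if necessary so that its
    ends are zeros. It has exactly [n + 1] zeros; [p] and [q] are the first and the last one inside,
    and [fw_pq] is what remains of minimality. *)
Record first_wide n k w s x y p q : Prop := FirstWide {
  fw_free : free n (6 * n + 2 + k) w;
  fw_end : forall x y, legal n w x y -> 5 * n + 2 + k + x <= 2 * y;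
  fw_n : 3 <= n;
  fw_k : 2 * n <= 3 * k + 2 /\ n + 1 <= 2 * k;
  fw_x : pos w false s x;
  fw_y : pos w false (s + n) y;
  fw_p : pos w true (x + 1 - s) p;
  fw_q : pos w true (y - s - n) q;
  fw_d : x + 2 * n + k + 1 <= y;
  fw_le : 5 * n + 2 + k + x <= 2 * y /\ y <= 3 * n + 1;
  fw_pq : q < p + 2 * n
}.

Lemma least_nat (P : nat -> Prop) m : P m ->
  exists y, P y /\ y <= m /\ forall y', y' < y -> ~ P y'.
Proof.
  induction m as [m IH] using (well_founded_induction lt_wf); intros H.
  destruct (classic (exists y', y' < m /\ P y')) as [(y' & H1 & H2)|G].
  - destruct (IH y' H1 H2) as (y & Hy & H3 & H4); exists y; split; [auto|split; [lia|auto]].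
  - exists m; split; [auto|split; [lia|]]; intros y' H1 H2; apply G; eauto.
Qed.

Lemma first_wide_ex n k w : 3 <= n -> 2 * n <= 3 * k + 2 -> n + 1 <= 2 * k ->
  free n (6 * n + 2 + k) w ->
  (forall x y, legal n w x y -> 5 * n + 2 + k + x <= 2 * y) ->
  exists s x y p q, first_wide n k w s x y p q \/
    first_wide n k (fun i => negb (w i)) s x y p q.
Proof.
  intros Hn Hk1 Hk2 F HE.
  set (P := fun y => exists c s x t, pos w c s x /\ pos w c t y /\ s + n <= t /\ x + 2 * n <= y).
  assert (H0 : exists m, P m /\ m <= 3 * n + 1).
  { destruct (prefix_good n w ltac:(lia)) as [H|H].
    - destruct H as (c & s & x & t & y & Px & Py & H); exists y; split; [|lia].
      exists c, s, x, t; splits.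
    - exfalso; destruct H as (c & c' & s0 & a & t0 & b & s & x & t & y & Pa & Pb & Px & Py & H).
      assert (5 * n + 2 + k + x <= 2 * y); [|lia].
      apply HE; split; [exists c', s, t; splits|right].
      exists c, a, b; split; [exists s0, t0; splits|lia]. }
  destruct H0 as (m & Pm & Hm).
  destruct (least_nat P m Pm) as (y & (c & s0 & x0 & t & Px0 & Py & H1 & H2) & Hy & Hmin).
  (* The left end is moved as far right as width and number of letters permit. *)
  assert (Hx : exists s x, pos w c s x /\ s + n <= t /\ x + 2 * n <= y /\
     (s + n = t \/ cn w c (y - 2 * n) = s)).
  { pose proof (pos_cn _ _ _ _ (y - 2 * n) Px0); pose proof (pos_range _ _ _ _ Px0).
    destruct (le_lt_dec (cn w c (y - 2 * n)) (t - n)) as [G|G].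
    - destruct (pos_ex w c (cn w c (y - 2 * n)) (y - 2 * n)) as (x & Px & Hx); [lia|].
      exists (cn w c (y - 2 * n)), x; splits.
    - destruct (pos_ex w c (t - n) (y - 2 * n)) as (x & Px & Hx); [lia|].
      exists (t - n), x; splits. }
  clear s0 x0 Px0 H1 H2; destruct Hx as (s & x & Px & H1 & H2 & H3).
  assert (Hxy : 5 * n + 2 + k + x <= 2 * y).
  { apply HE; split; [exists c, s, t; splits|now left]. }
  assert (Ey : cn w c y = t) by apply Py.
  pose proof (cn_sumc w c y) as Sy.
  pose proof (pos_le _ _ _ _ _ _ Px Py ltac:(lia)) as Cxy.
  assert (Hw : forall a u b v, pos w (negb c) a u -> pos w (negb c) b v -> a + n <= b ->
     v < y -> v < u + 2 * n).
  { intros a u b v Pu Pv K1 K2; destruct (le_lt_dec (u + 2 * n) v) as [K|K]; [exfalso|exact K].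
    apply (Hmin v K2); exists (negb c), a, u, b; splits. }
  pose proof (pos_range _ _ _ _ Px) as Rx; pose proof (pos_range _ _ _ _ Py) as Ry.
  (* With more letters of the end colour, minimality leaves long gaps after [x] and before [y], so
     [[x + 1, y - 1]] is a wide interval of the other colour that ends earlier. *)
  assert (Es : s + n = t).
  { destruct (Nat.eq_dec (s + n) t) as [E|E]; [exact E|exfalso].
    destruct (pos_ex w c (s + 1) y) as (x2 & P2 & _); [lia|].
      destruct (pos_ex w c (t - 1) y) as (y2 & Q2 & _); [lia|].
      assert (y < x2 + 2 * n) by (pose proof (pos_cn _ _ _ _ (y - 2 * n) P2); lia).
      pose proof (pos_le _ _ _ _ _ _ P2 Q2 ltac:(lia)).
      pose proof (pos_le _ _ _ _ _ _ Q2 Py ltac:(lia)).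
      assert (y2 < x + 2 * n).
      { destruct (le_lt_dec (x + 2 * n) y2) as [K|K]; [exfalso|exact K].
        apply (Hmin y2); [lia|]; exists c, s, x, (t - 1); splits. }
      destruct (pos_ex w (negb c) (x + 1 - s) y) as (p & Pp & _); [lia|].
      destruct (pos_ex w (negb c) (y - t) y) as (q & Pq & _); [lia|].
      assert (p <= x + 1) by (pose proof (pos_oppc _ _ _ _ _ _ P2 Pp); lia).
      assert (y <= q + 1) by (pose proof (pos_oppc _ _ _ _ _ _ Q2 Pq); lia).
      assert (q < y) by (pose proof (pos_oppc _ _ _ _ _ _ Py Pq); lia).
      assert (q < p + 2 * n); [apply (Hw _ _ _ _ Pp Pq)|]; lia. }
  assert (Py' : pos w c (s + n) y) by (rewrite Es; exact Py).
  destruct (pos_ex w (negb c) (x + 1 - s) y) as (p & Pp & _); [lia|].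
  destruct (pos_ex w (negb c) (y - s - n) y) as (q & Pq & _); [lia|].
  pose proof (pos_oppc _ _ _ _ _ _ Py Pq) as Cq.
  pose proof (Hw _ _ _ _ Pp Pq) as Hpq.
  exists s, x, y, p, q.
  destruct c; [right|left]; split; auto; try lia;
    try (apply pos_negb; assumption); try (apply free_negb; assumption).
  intros x' y' Lg; apply HE, legal_negb, Lg.
Qed.

Lemma fw_law1 n k w s x y p q c a u b v : first_wide n k w s x y p q ->
  pos w c a u -> pos w c b v -> a + n <= b -> u + 2 * n <= v -> 5 * n + 2 + k + u <= 2 * v.
Proof.
  intros W Pu Pv H1 H2; apply (fw_end _ _ _ _ _ _ _ _ W); split; [|left; lia].
  exists c, a, b; splits.
Qed.

Lemma fw_law2 n k w s x y p q c0 s0 a t0 b c s1 u t1 v : first_wide n k w s x y p q ->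
  pos w c0 s0 a -> pos w c0 t0 b -> pos w c s1 u -> pos w c t1 v ->
  s0 + n <= t0 -> b < u -> b + u <= v + a -> s1 + n <= t1 -> 5 * n + 2 + k + u <= 2 * v.
Proof.
  intros W Pa Pb Pu Pv H1 H2 H3 H4; apply (fw_end _ _ _ _ _ _ _ _ W); split; [|right].
  - exists c, s1, t1; splits.
  - exists c0, a, b; split; [exists s0, t0; splits|lia].
Qed.

Lemma fw_basic n k w s x y p q : first_wide n k w s x y p q ->
  1 <= s /\ s <= x /\ x < p /\ p <= x + n /\ q < y /\ s + n < y /\
  p + y <= q + x + n + 1 /\ y <= q + n.
Proof.
  intros [F E Hn Hk Px Py Pp Pq Hd Hl Hpq].
  pose proof (pos_range _ _ _ _ Px); pose proof (pos_same _ _ _ _ _ _ Px Py).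
  pose proof (pos_opp _ _ _ _ _ Pp Px); pose proof (pos_opp _ _ _ _ _ Pp Py).
  pose proof (pos_opp _ _ _ _ _ Pq Py); pose proof (pos_same _ _ _ _ _ _ Pp Pq).
  lia.
Qed.

Lemma fw_zeros n k w s x y p q i : first_wide n k w s x y p q ->
  q < i -> i <= y -> pos w false (i - (y - s - n)) i.
Proof.
  intros W H1 H2; pose proof (fw_basic _ _ _ _ _ _ _ _ W).
  destruct W as [F E Hn Hk Px Py Pp Pq Hd Hl Hpq].
  assert (Ey : cn w false y = s + n) by apply Py.
  destruct (pos_ex w false (i - (y - s - n)) y) as (j & Pj & Hj).
  { pose proof (pos_opp _ _ _ _ _ Pq Py); lia. }
  assert (j = i); [|subst; assumption].
  pose proof (pos_opp _ _ _ _ _ Pq Pj); pose proof (pos_same _ _ _ _ _ _ Pj Py); lia.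
Qed.

(* If a one follows [y], a short wide interval of ones would end there unless
   the initial run of zeros of [x, y] is long. *)
Lemma fw_one_next n k w s x y p q : first_wide n k w s x y p q ->
  pos w true (y - s - n + 1) (y + 1) -> y + 2 <= p + 2 * n.
Proof.
  intros W P1; pose proof (fw_basic _ _ _ _ _ _ _ _ W).
  destruct (le_lt_dec (y + 2) (p + 2 * n)) as [|G]; [assumption|exfalso].
  assert (WW := W); destruct W as [F E Hn Hk Px Py Pp Pq Hd Hl Hpq].
  pose proof (pos_cn _ _ _ _ (y + 1 - 2 * n) Pp).
  pose proof (pos_range _ _ _ _ Pp).
  destruct (pos_ex w true (cn w true (y + 1 - 2 * n)) (y + 1 - 2 * n)) as (o & Po & Ho); [lia|].
  pose proof (pos_same _ _ _ _ _ _ Pp Po).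
  pose proof (fw_law1 _ _ _ _ _ _ _ _ _ _ _ _ _ WW Po P1).
  pose proof (cn_lip w false (y + 1 - 2 * n) q ltac:(lia)).
  pose proof (cn_sum w (y + 1 - 2 * n)); pose proof (cn_sum w q).
  destruct Pq as (_ & _ & Eq).
  lia.
Qed.

(** [[x, y]] holds [y - x - n] ones, more than [n], so its first [n + 1] ones form a window. *)
Lemma fw_window n k w s x y p q : first_wide n k w s x y p q ->
  exists on, pos w true (x + 1 - s + n) on /\ p + n <= on /\ on <= q /\ on + y <= q + x + 2 * n + 1.
Proof.
  intros W; pose proof (fw_basic _ _ _ _ _ _ _ _ W).
  destruct W as [F E Hn Hk Px Py Pp Pq Hd Hl Hpq].
  assert (Eq : cn w true q = y - s - n) by apply Pq.
  destruct (pos_ex w true (x + 1 - s + n) q) as (on & Pn & Hon); [lia|].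
  exists on; pose proof (pos_same _ _ _ _ _ _ Pn Pq); pose proof (pos_same _ _ _ _ _ _ Pp Pn).
  splits.
Qed.

(** Few ones follow [3n + 1], so many zeros do. The interval [[x, y]] limits how far they reach,
    while the window [[p, on]] makes a block of zeros behind [q] legal, and [fw_end] pushes its end
    to the right. *)
Lemma fw_zero_tail n k w s x y p q : first_wide n k w s x y p q ->
  cn w true (6 * n + 2 + k) <= cn w true (3 * n + 1) + n -> False.
Proof.
  intros W HT; pose proof (fw_basic _ _ _ _ _ _ _ _ W) as NB.
  destruct (fw_window _ _ _ _ _ _ _ _ W) as (on & Pn & N1 & N2 & N3).
  assert (WW := W); destruct W as [F E Hn Hk Px Py Pp Pq Hd Hl Hpq].
  set (M := 6 * n + 2 + k) in *.
  assert (EM : M = 6 * n + 2 + k) by reflexivity.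
  assert (HZ : 3 * n + 1 + k + s <= cn w false M).
  { pose proof (cn_sum w M); pose proof (cn_sum w y).
    pose proof (cn_lip w true y (3 * n + 1) ltac:(lia)).
    destruct Py as (_ & _ & Ey); lia. }
  set (Z := cn w false M) in *.
  destruct (pos_ex w false Z M) as (lz & Pl & Hlz); [lia|].
  destruct (pos_ex w false (s + n + 1) M) as (s1 & P1 & Hs1); [lia|].
  clearbody Z; clearbody M.
  assert (B1 : y < s1) by (pose proof (pos_same _ _ _ _ _ _ Py P1); lia).
  assert (Q1 : lz + x < s1 + y).
  { apply (free1 _ _ _ F _ _ _ _ _ _ _ _ _ _ Px Py P1 Pl); lia. }
  pose proof (fw_zeros _ _ _ _ _ _ _ _ (q + 1) WW ltac:(lia) ltac:(lia)) as Pa.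
  destruct (pos_ex w false (q + 1 - (y - s - n) + (on - p)) lz) as (b & Pb & Hb).
  { destruct Pl as (_ & _ & ->); lia. }
  assert (B2 : q + 1 + (on - p) <= b) by (pose proof (pos_same _ _ _ _ _ _ Pa Pb); lia).
  assert (B3 : b + Z <= lz + (q + 1 - (y - s - n) + (on - p))).
  { pose proof (pos_same _ _ _ _ _ _ Pb Pl); lia. }
  assert (Q2 : 5 * n + 2 + k + (q + 1) <= 2 * b).
  { apply (fw_law2 _ _ _ _ _ _ _ _ _ _ _ _ _ _ _ _ _ _ WW Pp Pn Pa Pb); lia. }
  destruct (Nat.eq_dec s1 (y + 1)) as [G|G]; [lia|].
  assert (P2 : pos w true (y - s - n + 1) (y + 1)).
  { destruct (pos_here w (y + 1)) as [Q|Q]; [lia|..].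
    - replace (y - s - n + 1) with (cn w true (y + 1)); [exact Q|].
      pose proof (pos_cn _ _ _ _ (y + 1) P1); pose proof (pos_cn _ _ _ _ (y + 1) Py).
      pose proof (cn_sum w (y + 1)); lia.
    - pose proof (pos_same _ _ _ _ _ _ Q P1); pose proof (pos_same _ _ _ _ _ _ Py Q); lia. }
  pose proof (fw_one_next _ _ _ _ _ _ _ _ WW P2) as Q3.
  (* Otherwise [p + 2n] is a one, and [[p, p + 2n]] is too short for [fw_end]. *)
  assert (Q4 : s1 <= p + 2 * n).
  { destruct (le_lt_dec s1 (p + 2 * n)) as [|K]; [assumption|exfalso].
    destruct (pos_here w (p + 2 * n)) as [Q|Q]; [lia|..].
    - pose proof (cn_sum w (p + 2 * n)).
      pose proof (pos_cn _ _ _ _ (p + 2 * n) P1); pose proof (pos_cn _ _ _ _ (p + 2 * n) Py).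
      pose proof (fw_law1 _ _ _ _ _ _ _ _ _ _ _ _ _ WW Pp Q); lia.
    - pose proof (pos_same _ _ _ _ _ _ Q P1); pose proof (pos_same _ _ _ _ _ _ Py Q); lia. }
  lia.
Qed.

Lemma fw_ones_count n k w s x y p q : first_wide n k w s x y p q ->
  cn w false (6 * n + 2 + k) <= cn w false (3 * n + 1) + n ->
  n + 1 + k + y <= cn w true (6 * n + 2 + k) + s.
Proof.
  intros W HT; destruct W as [F E Hn Hk Px Py Pp Pq Hd Hl Hpq].
  pose proof (cn_sum w (6 * n + 2 + k)); pose proof (cn_sum w y).
  pose proof (cn_lip w false y (3 * n + 1) ltac:(lia)).
  destruct Py as (_ & _ & Ey); lia.
Qed.

(** If [z] is the first one from [p + 2n] on, then [[p, z]] is wide and [fw_end] puts [z] far to the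
    right, whereas [[x, y]] limits the ones from [y + 1] on. *)
Lemma fw_one_tail_one n k w s x y p q : first_wide n k w s x y p q ->
  cn w false (6 * n + 2 + k) <= cn w false (3 * n + 1) + n ->
  pos w true (y - s - n + 1) (y + 1) -> False.
Proof.
  intros W HT P1; pose proof (fw_basic _ _ _ _ _ _ _ _ W) as NB.
  pose proof (fw_one_next _ _ _ _ _ _ _ _ W P1) as Q0.
  pose proof (fw_ones_count _ _ _ _ _ _ _ _ W HT) as HI; clear HT.
  assert (WW := W); destruct W as [F E Hn Hk Px Py Pp Pq Hd Hl Hpq].
  set (M := 6 * n + 2 + k) in *.
  assert (EM : M = 6 * n + 2 + k) by reflexivity.
  set (I := cn w true M) in *.
  destruct (pos_ex w true I M) as (lo & Pl & Hlo); [lia|].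
  assert (Ep : cn w true (p + 2 * n - 1) + s <= p + n - 1 /\
     y - s - n + 1 <= cn w true (p + 2 * n - 1)).
  { pose proof (cn_lip w true (y + 1) (p + 2 * n - 1) ltac:(lia)).
    destruct P1 as (_ & _ & E1); lia. }
  destruct (pos_ex w true (cn w true (p + 2 * n - 1) + 1) M) as (z & Pz & Hz); [lia|].
  clearbody M I.
  assert (B1 : p + 2 * n <= z) by (pose proof (pos_cn _ _ _ _ (p + 2 * n - 1) Pz); lia).
  assert (Q1 : lo + x < y + 1 + y).
  { apply (free1 _ _ _ F _ _ _ _ _ _ _ _ _ _ Px Py P1 Pl); lia. }
  assert (Q2 : 5 * n + 2 + k + p <= 2 * z).
  { apply (fw_law1 _ _ _ _ _ _ _ _ _ _ _ _ _ WW Pp Pz); lia. }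
  assert (B2 : z + I <= lo + (cn w true (p + 2 * n - 1) + 1)).
  { pose proof (pos_same _ _ _ _ _ _ Pz Pl); lia. }
  lia.
Qed.

Lemma fw_zero_run n k w s x y p q z i : first_wide n k w s x y p q ->
  pos w true (y - s - n + 1) z -> q < i -> i < z -> pos w false (i - (y - s - n)) i.
Proof.
  intros W Pz H1 H2; pose proof (fw_basic _ _ _ _ _ _ _ _ W).
  destruct W as [F E Hn Hk Px Py Pp Pq Hd Hl Hpq].
  pose proof (pos_cn _ _ _ _ i Pq); pose proof (pos_cn _ _ _ _ i Pz); pose proof (cn_sum w i).
  destruct (pos_here w i) as [P|P]; [lia|..].
  - pose proof (pos_same _ _ _ _ _ _ P Pq); pose proof (pos_same _ _ _ _ _ _ P Pz); lia.
  - replace (i - (y - s - n)) with (cn w false i) by lia; exact P.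
Qed.

(* A window of [n + 1] ones in [p, q] yields two further sets of ones after [z]
   unless its diameter is the largest possible one. *)
Lemma fw_one_tail_window n k w s x y p q z lo I a u b v : first_wide n k w s x y p q ->
  n + 1 + k + y <= I + s -> pos w true (y - s - n + 1) z -> y + 2 <= z ->
  pos w true I lo -> lo <= 6 * n + 2 + k ->
  pos w true a u -> pos w true b v -> a + n <= b -> v <= q -> u + n <= v ->
  v + y <= u + x + 4 * n ->
  lo + x < z + y /\ 2 * (I + s) + x + 1 <= 2 * (v - u) + 3 * y + 2 - 2 * n.
Proof.
  intros W HI Pz Hz Pl Hlo Pu Pv H1 H2 H3 H4; pose proof (fw_basic _ _ _ _ _ _ _ _ W) as NB.
  assert (WW := W); destruct W as [F E Hn Hk Px Py Pp Pq Hd Hl Hpq].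
  set (D := v - u) in *; assert (ED : v = u + D) by lia; clearbody D; subst v.
  assert (Q1 : lo + x < z + y).
  { apply (free1 _ _ _ F _ _ _ _ _ _ _ _ _ _ Px Py Pz Pl); lia. }
  split; [exact Q1|].
  assert (Elo : cn w true lo = I) by apply Pl.
  destruct (le_lt_dec (y - s - n + 1 + D + 1 + n) I) as [G|G]; [|lia].
  destruct (pos_ex w true (y - s - n + 1 + D) lo) as (z2 & P2 & _); [lia|].
  destruct (pos_ex w true (y - s - n + 1 + D + 1) lo) as (z3 & P3 & _); [lia|].
  assert (B1 : z + D <= z2) by (pose proof (pos_same _ _ _ _ _ _ Pz P2); lia).
  assert (B2 : z2 < z3) by (pose proof (pos_same _ _ _ _ _ _ P2 P3); lia).
  assert (B3 : z3 + I <= lo + (y - s - n + 1 + D + 1)).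
  { pose proof (pos_same _ _ _ _ _ _ P3 Pl); lia. }
  assert (B4 : z2 + I <= lo + (y - s - n + 1 + D)).
  { pose proof (pos_same _ _ _ _ _ _ P2 Pl); lia. }
  assert (Q2 : lo + z < z3 + z2).
  { apply (free2 _ _ _ F _ _ _ _ _ _ _ _ _ _ _ _ _ _ _ Pu Pv Pz P2 P3 Pl); lia. }
  lia.
Qed.

Lemma fw_one_tail_zero n k w s x y p q z : first_wide n k w s x y p q ->
  cn w false (6 * n + 2 + k) <= cn w false (3 * n + 1) + n ->
  pos w true (y - s - n + 1) z -> y + 2 <= z -> False.
Proof.
  intros W HT Pz Hz; pose proof (fw_basic _ _ _ _ _ _ _ _ W) as NB.
  pose proof (fw_ones_count _ _ _ _ _ _ _ _ W HT) as HI; clear HT.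
  destruct (fw_window _ _ _ _ _ _ _ _ W) as (on & Pn & N1 & N2 & N3).
  destruct (pos_ex w true (cn w true (6 * n + 2 + k)) (6 * n + 2 + k)) as (lo & Pl & Hlo).
  { destruct W as [F E Hn Hk Px Py Pp Pq Hd Hl Hpq]; lia. }
  set (I := cn w true (6 * n + 2 + k)) in *; clearbody I.
  assert (WW := W); destruct W as [F E Hn Hk Px Py Pp Pq Hd Hl Hpq].
  assert (Eq : cn w true q = y - s - n) by apply Pq.
  destruct (pos_ex w true (y - s - 2 * n) q) as (op & Po & Hop); [lia|].
  assert (N4 : op + n <= q) by (pose proof (pos_le _ _ _ _ _ _ Po Pq ltac:(lia)); lia).
  assert (N5 : p + y <= op + x + 2 * n + 1) by (pose proof (pos_le _ _ _ _ _ _ Pp Po ltac:(lia)); lia).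
  destruct (fw_one_tail_window _ _ _ _ _ _ _ _ _ _ _ _ _ _ _ WW HI Pz Hz Pl Hlo Pp Pn)
    as (Q0 & Q1); [lia..|].
  destruct (fw_one_tail_window _ _ _ _ _ _ _ _ _ _ _ _ _ _ _ WW HI Pz Hz Pl Hlo Po Pq)
    as (_ & Q2); [lia..|].
  (* The estimates for the first and the last window of ones leave no slack: [k] and the
     configuration are now rigid. *)
  assert (T1 : 3 * k + 2 = 2 * n) by lia.
  assert (T2 : y = x + 2 * n + k + 1) by lia.
  assert (T3 : on + k + 1 = p + 2 * n /\ q + 1 = p + 2 * n /\ op = p + k) by lia.
  assert (T4 : I + s = n + 1 + k + y) by lia.
  assert (T5 : lo = z + 2 * n + k) by (pose proof (pos_le _ _ _ _ _ _ Pz Pl ltac:(lia)); lia).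
  clear Q0 Q1 Q2 N1 N2 N3 N4 N5 Hl Hd HI.
  assert (Hrun : forall i, q < i -> i < z -> exists j, pos w false j i /\ j + y = i + s + n).
  { intros i H1 H2; exists (i - (y - s - n)); split; [|lia].
    now apply (fw_zero_run _ _ _ _ _ _ _ _ _ _ WW Pz). }
  remember (x + 1 - s) as ip eqn:Eip; assert (Jp : ip + s = x + 1) by lia.
  remember (y - s - n) as iq eqn:Eiq; assert (Jq : iq + s + n = y) by lia.
  remember (y - s - 2 * n) as io eqn:Eio; assert (Jo : io + s + 2 * n = y) by lia.
  clear Eip Eiq Eio WW.
  (* An early one [o] makes [[o, z]] wide, hence longer than the interval of ones from [z1] to
     [lo]. *)
  assert (LZ : forall i o, pos w true i o -> i + s + 2 * n <= y + 1 -> o + 2 * n <= z ->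
     2 * n + k + o <= z).
  { intros i o Pi H1 H2.
    destruct (pos_ex w true (iq + 2) lo) as (z1 & P1 & _).
    { destruct Pl as (_ & _ & ->); lia. }
    pose proof (pos_le _ _ _ _ _ _ P1 Pl ltac:(lia)).
    pose proof (pos_le _ _ _ _ _ _ Pz P1 ltac:(lia)).
    assert (lo + o < z1 + z); [|lia].
    apply (free1 _ _ _ F _ _ _ _ _ _ _ _ _ _ Pi Pz P1 Pl); lia. }
  (* [jx] is the rank of the first zero behind [p]; since [op = p + k], all letters from [p] to [op]
     are ones. *)
  remember (p + s - x) as jx eqn:Ejx; assert (Jx : jx + x = p + s) by lia; clear Ejx.
  assert (En : cn w false on + k + 2 = jx + n).
  { pose proof (cn_sum w on); destruct Pn as (_ & _ & En); lia. }
  destruct (pos_ex w false jx on) as (x0 & P0 & Hx0); [lia|].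
  assert (B1 : p + k + 1 <= x0) by (pose proof (pos_opp _ _ _ _ _ Po P0); lia).
  assert (B2 : x0 <= p + n) by (pose proof (pos_opp _ _ _ _ _ Pn P0); lia).
  assert (B3 : z <= x0 + 2 * n).
  { destruct (le_lt_dec z (x0 + 2 * n)) as [|G]; [assumption|exfalso].
    destruct (Hrun (x0 + 2 * n)) as (j & P1 & Hj); [lia|lia|].
    assert (lo + x0 < z + (x0 + 2 * n)); [|lia].
    apply (free1 _ _ _ F _ _ _ _ _ _ _ _ _ _ P0 P1 Pz Pl); lia. }
  destruct (le_lt_dec z (p + k + 2 * n)) as [G|G].
  (* The letter at [z - 2n] is one of these ones, against [LZ]. *)
  - assert (J1 : exists i, i + 2 * n + p = ip + z) by (exists (ip + z - 2 * n - p); lia).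
    destruct J1 as (i & J1).
    destruct (pos_ex w true i op) as (o & Pi & Ho).
    { destruct Po as (_ & _ & ->); lia. }
    pose proof (pos_le _ _ _ _ _ _ Pp Pi ltac:(lia)).
    pose proof (pos_le _ _ _ _ _ _ Pi Po ltac:(lia)).
    pose proof (LZ _ _ Pi ltac:(lia) ltac:(lia)); lia.
  - destruct (Nat.eq_dec x0 (p + k + 1)) as [G1|G1].
    + pose proof (LZ _ _ Po ltac:(lia) ltac:(lia)); lia.
    + destruct (pos_ex w true (io + 1) q) as (o & Pi & Ho); [lia|].
      assert (B4 : o <= p + k + 1) by (pose proof (pos_opp _ _ _ _ _ Pi P0); lia).
      pose proof (pos_le _ _ _ _ _ _ Po Pi ltac:(lia)).
      pose proof (LZ _ _ Pi ltac:(lia) ltac:(lia)); lia.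
Qed.

Lemma fw_one_tail n k w s x y p q : first_wide n k w s x y p q ->
  cn w false (6 * n + 2 + k) <= cn w false (3 * n + 1) + n -> False.
Proof.
  intros W HT; pose proof (fw_basic _ _ _ _ _ _ _ _ W) as NB.
  pose proof (fw_ones_count _ _ _ _ _ _ _ _ W HT) as HI.
  assert (WW := W); destruct W as [F E Hn Hk Px Py Pp Pq Hd Hl Hpq].
  destruct (pos_ex w true (y - s - n + 1) (6 * n + 2 + k)) as (z & Pz & _); [lia|].
  assert (y < z).
  { pose proof (pos_opp _ _ _ _ _ Pz Py); lia. }
  destruct (Nat.eq_dec z (y + 1)) as [G|G].
  - subst z; now apply (fw_one_tail_one _ _ _ _ _ _ _ _ WW).
  - apply (fw_one_tail_zero _ _ _ _ _ _ _ _ z WW); auto; lia.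
Qed.

Theorem not_free n k w : 3 <= n -> 2 * n <= 3 * k + 2 -> n + 1 <= 2 * k -> k <= n ->
  ~ free n (6 * n + 2 + k) w.
Proof.
  intros Hn Hk1 Hk2 Hk3.
  assert (WL : forall w, w (6 * n + 2 + k) = true -> ~ free n (6 * n + 2 + k) w).
  { clear w; intros w HM F.
    destruct (le_lt_dec (cn w true (3 * n + 1) + n + 1) (cn w true (6 * n + 2 + k))) as [G|G].
    - now apply (not_free_many_ones n k w).
    - destruct (first_wide_ex n k w Hn Hk1 Hk2 F) as (s & x & y & p & q & [W|W]).
      + intros x y; apply end_bound; auto; [lia|rewrite HM; lia].
      + apply (fw_zero_tail _ _ _ _ _ _ _ _ W); lia.
      + apply (fw_one_tail _ _ _ _ _ _ _ _ W); rewrite !cn_negb; cbn [negb]; lia. }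
  destruct (w (6 * n + 2 + k)) eqn:E; [now apply WL|intros F].
  apply (WL (fun i => negb (w i))); [now rewrite E|now apply free_negb].
Qed.

(** * Small parameters *)

(* Words are read backwards: the head of [r] is the letter at position [length r]. *)
Fixpoint agrees (w : nat -> bool) (r : list bool) : Prop :=
  match r with
  | nil => True
  | b :: r' => w (length r) = b /\ agrees w r'
  end.

(** [j] counts the letters of colour [c] already passed. With [j = 0] and a head of colour [c] the
    result lists the left ends of the good intervals that end at the head. *)
Fixpoint starts n c (r : list bool) (j : nat) : list nat :=
  match r with
  | nil => nil
  | b :: r' =>
      if Bool.eqb b c then
        if n <=? j then length r :: starts n c r' (S j) else starts n c r' (S j)
      else starts n c r' j
  end.

Definition below (L : list (nat * nat)) x d : bool :=
  existsb (fun ed => (fst ed <? x) && (snd ed <=? d)) L.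

(* [L1] and [L2] hold the ends and diameters of good and of legal intervals. *)
Fixpoint search n f r (L1 L2 : list (nat * nat)) : bool :=
  match f with
  | 0 => false
  | S f' =>
      let step b :=
        let r' := b :: r in
        let y := length r' in
        let xs := starts n b r' 0 in
        if existsb (fun x => below L2 x (y - x)) xs then true
        else search n f' r'
          (map (fun x => (y, y - x)) xs ++ L1)
          (map (fun x => (y, y - x))
             (filter (fun x => (2 * n <=? y - x) || below L1 x (y - x)) xs) ++ L2) in
      if step true then step false else false
  end.

(** [T], the rank of the right end, stays constant along the recursion: [j] grows exactly when the
    count of the remaining word drops. *)
Lemma starts_sound n w c r j x T : agrees w r -> In x (starts n c r j) ->
  cn w c (length r) + j = T -> pos w c (cn w c x) x /\ cn w c x + n <= T /\ x <= length r.
Proof.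
  revert j; induction r as [|b r IH]; simpl starts; intros j A H E; [contradiction|].
  destruct A as (A1 & A2); change (length (b :: r)) with (S (length r)) in *.
  assert (Ec : cn w c (S (length r)) = cn w c (length r) + if Bool.eqb b c then 1 else 0).
  { simpl; rewrite A1; reflexivity. }
  destruct (Bool.eqb b c) eqn:Eb.
  - apply Bool.eqb_prop in Eb; rewrite Eb in A1.
    destruct (n <=? j) eqn:Ej.
    + destruct H as [H|H].
      * subst x; apply Nat.leb_le in Ej.
        split; [repeat split; [lia|exact A1]|lia].
      * destruct (IH (S j) A2 H) as (? & ? & ?); [lia|]; splits.
    + destruct (IH (S j) A2 H) as (? & ? & ?); [lia|]; splits.
  - destruct (IH j A2 H) as (? & ? & ?); [lia|]; splits.
Qed.

Definition goods_in n w (L : list (nat * nat)) : Prop :=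
  forall e d, In (e, d) L -> exists c x, good n w c x e /\ x + d = e.

Definition legals_in n w (L : list (nat * nat)) : Prop :=
  forall e d, In (e, d) L -> exists x, legal n w x e /\ x + d = e.

Lemma below_ex L x d : below L x d = true -> exists e d', In (e, d') L /\ e < x /\ d' <= d.
Proof.
  unfold below; rewrite existsb_exists; intros ((e, d') & H1 & H2).
  apply andb_prop in H2; simpl in H2; destruct H2 as (H2 & H3).
  apply Nat.ltb_lt in H2; apply Nat.leb_le in H3; exists e, d'; auto.
Qed.

(** Both branches of the search succeed, in particular that of the next letter of [w]; following it
    keeps both lists certified until a hit contradicts [free]. *)
Lemma search_sound n M w f : forall r L1 L2,
  search n f r L1 L2 = true -> agrees w r -> goods_in n w L1 -> legals_in n w L2 ->
  length r + f <= M -> ~ free n M w.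
Proof.
  induction f as [|f IH]; simpl search; intros r L1 L2 H A G1 G2 Hl F; [discriminate|].
  set (b := w (S (length r))).
  assert (A' : agrees w (b :: r)) by (split; auto).
  assert (Hb : (if existsb (fun x => below L2 x (S (length r) - x)) (starts n b (b :: r) 0)
    then true else search n f (b :: r)
      (map (fun x => (S (length r), S (length r) - x)) (starts n b (b :: r) 0) ++ L1)
      (map (fun x => (S (length r), S (length r) - x))
        (filter (fun x => (2 * n <=? S (length r) - x) || below L1 x (S (length r) - x))
          (starts n b (b :: r) 0)) ++ L2)) = true).
  { match type of H with (if ?X then ?Y else _) = true =>
      assert (X = true /\ Y = true) as [HX HY] by (destruct X; [auto|discriminate]) end.
    destruct b; [exact HX|exact HY]. }
  clear H.
  set (y := S (length r)) in *; set (xs := starts n b (b :: r) 0) in *.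
  assert (Hxs : forall x, In x xs -> good n w b x y /\ x <= y).
  { intros x Hx.
    destruct (starts_sound n w b (b :: r) 0 x (cn w b y) A' Hx) as (P & Q & R); [simpl; lia|].
    split; [|exact R].
    exists (cn w b x), (cn w b y); split; [exact P|split; [|exact Q]].
    repeat split; unfold y; auto; lia. }
  clearbody xs; assert (Ey : y = S (length r)) by reflexivity; clearbody y.
  destruct (existsb (fun x => below L2 x (y - x)) xs) eqn:E.
  - apply existsb_exists in E; destruct E as (x & Hx & Hb').
    destruct (below_ex _ _ _ Hb') as (e & d & He & H1 & H2).
    destruct (G2 e d He) as (x2 & Lg & Ed).
    destruct (Hxs x Hx) as (Gx & Hxy).
    assert (y + x2 < x + e); [|lia].
    apply (F x2 e Lg b x y Gx H1); lia.
  - apply (IH _ _ _ Hb A'); auto.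
    + intros e d He; apply in_app_or in He; destruct He as [He|He]; [|now apply G1].
      apply in_map_iff in He; destruct He as (x & Ex & Hx).
      destruct (Hxs x Hx) as (Gx & Hxy); injection Ex as <- <-.
      exists b, x; split; [exact Gx|lia].
    + intros e d He; apply in_app_or in He; destruct He as [He|He]; [|now apply G2].
      apply in_map_iff in He; destruct He as (x & Ex & Hx).
      apply filter_In in Hx; destruct Hx as (Hx & Hc).
      destruct (Hxs x Hx) as (Gx & Hxy); injection Ex as <- <-.
      exists x; split; [|lia].
      split; [now exists b|].
      apply orb_prop in Hc; destruct Hc as [Hc|Hc].
      * apply Nat.leb_le in Hc; left; lia.
      * destruct (below_ex _ _ _ Hc) as (e & d & He' & H1 & H2).
        destruct (G1 e d He') as (c' & u & Gu & Eu).
        right; exists c', u, e; split; [exact Gu|lia].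
    + simpl; lia.
Qed.

(** The pairs [n = 1], [k = 1] and [n = 2], [k = 1] violate the hypotheses of [not_free] and are
    settled by exhaustive search. *)
Lemma not_free1 w : ~ free 1 9 w.
Proof.
  apply (search_sound 1 9 w 9 nil nil nil); [now vm_compute|exact I|now intros ? ? []|now intros ? ? []|simpl; lia].
Qed.

Lemma not_free2 w : ~ free 2 15 w.
Proof.
  apply (search_sound 2 15 w 15 nil nil nil); [now vm_compute|exact I|now intros ? ? []|now intros ? ? []|simpl; lia].
Qed.

(** * Free words *)

Definition word (l : list bool) (i : nat) : bool := nth (i - 1) l false.

Definition goodb n w c x y : bool :=
  (1 <=? x) && Bool.eqb (w x) c && (1 <=? y) && Bool.eqb (w y) c &&
  (cn w c x + n <=? cn w c y).

Definition goods n M w : list (nat * nat) :=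
  filter (fun xy => goodb n w true (fst xy) (snd xy) || goodb n w false (fst xy) (snd xy))
    (list_prod (seq 1 M) (seq 1 M)).

Definition freeb n M w : bool :=
  let G := goods n M w in
  forallb (fun xy : nat * nat =>
    let (x, y) := xy in
    if (x + 2 * n <=? y) ||
       existsb (fun uv : nat * nat => let (u, v) := uv in (v <? x) && (v + x <=? y + u)) G
    then forallb (fun uv : nat * nat => let (u, v) := uv in (u <=? y) || (v + x <? u + y)) G
    else true) G.

Lemma goods_complete n M w c x y : good n w c x y -> y <= M -> In (x, y) (goods n M w).
Proof.
  intros (s & t & Px & Py & H) Hy.
  pose proof (pos_same _ _ _ _ _ _ Px Py).
  destruct Px as (Px1 & Px2 & Px3), Py as (Py1 & Py2 & Py3).
  unfold goods; apply filter_In; split.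
  - apply in_prod; apply in_seq; lia.
  - assert (goodb n w c x y = true); [|simpl; destruct c; rewrite H1; auto using orb_true_r].
    unfold goodb; rewrite Px2, Py2, Px3, Py3, Bool.eqb_reflx.
    repeat (apply andb_true_intro; split); auto; apply Nat.leb_le; lia.
Qed.

Lemma freeb_sound n M w : freeb n M w = true -> free n M w.
Proof.
  intros H x y [(c & Gx) Lg] c' u v Gu Huy Hv.
  assert (Hy : y <= M).
  { destruct Gu as (s & t & Pu & Pv & K); pose proof (pos_same _ _ _ _ _ _ Pu Pv); lia. }
  unfold freeb in H; rewrite forallb_forall in H.
  specialize (H _ (goods_complete _ M _ _ _ _ Gx Hy)); simpl in H.
  assert (Hx : x <= y).
  { destruct Gx as (s & t & Pu & Pv & K); pose proof (pos_same _ _ _ _ _ _ Pu Pv); lia. }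
  match type of H with (if ?X then _ else _) = true => assert (E : X = true) end.
  { apply orb_true_intro; destruct Lg as [Lg|(c0 & u0 & v0 & G0 & H1 & H2)].
    - left; apply Nat.leb_le; simpl; lia.
    - right; apply existsb_exists; exists (u0, v0); split.
      + apply (goods_complete _ M _ _ _ _ G0); lia.
      + apply andb_true_intro; split; [apply Nat.ltb_lt|apply Nat.leb_le]; lia. }
  rewrite E, forallb_forall in H.
  specialize (H _ (goods_complete _ M _ _ _ _ Gu Hv)); simpl in H.
  apply orb_prop in H; destruct H as [H|H]; [apply Nat.leb_le in H|apply Nat.ltb_lt in H]; lia.
Qed.

(** For [n = 1] and [n = 4] these words are one letter longer than the general family [tail]
    reaches, which accounts for [delta]. *)
Definition tail1 : nat -> bool :=
  word (false :: true :: true :: false :: true :: true :: true :: false :: nil).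

Definition tail4 : nat -> bool :=
  word (repeat false 4 ++ repeat true 8 ++ repeat false 4 ++ repeat true 2 ++
        repeat false 7 ++ repeat true 3).

Lemma free_tail1 : free 1 8 tail1.
Proof. apply freeb_sound; now vm_compute. Qed.

Lemma free_tail4 : free 4 28 tail4.
Proof. apply freeb_sound; now vm_compute. Qed.

(* [0^n 1^k 0^(n-k) 1^n 0^(2n+1+k) 1^n] *)
Definition tail n k (i : nat) : bool :=
  ((n <? i) && (i <=? n + k)) || ((2 * n <? i) && (i <=? 3 * n)) || (5 * n + 1 + k <? i).

Lemma tail_cn n k i : k <= n ->
  cn (tail n k) true i =
    (Nat.min i (n + k) - n) + (Nat.min i (3 * n) - 2 * n) + (i - (5 * n + 1 + k)).
Proof.
  intros Hk; induction i as [|i IH]; [simpl; lia|].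
  cbn [cn]; rewrite IH; unfold tail.
  destruct (Nat.ltb_spec n (S i)), (Nat.leb_spec (S i) (n + k)),
    (Nat.ltb_spec (2 * n) (S i)), (Nat.leb_spec (S i) (3 * n)),
    (Nat.ltb_spec (5 * n + 1 + k) (S i)); cbn [andb orb Bool.eqb]; lia.
Qed.

Lemma tail_pos n k c t p : k <= n -> pos (tail n k) c t p ->
  if c then (n < p <= n + k /\ t + n = p) \/ (2 * n < p <= 3 * n /\ t + 2 * n = p + k) \/
            (5 * n + 1 + k < p /\ t + 4 * n + 1 = p)
  else (p <= n /\ t = p) \/ (n + k < p <= 2 * n /\ t + k = p) \/
       (3 * n < p <= 5 * n + 1 + k /\ t + n + k = p).
Proof.
  intros Hk (H1 & H2 & H3).
  pose proof (cn_sum (tail n k) p); pose proof (tail_cn n k p Hk).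
  revert H2; unfold tail.
  destruct (Nat.ltb_spec n p), (Nat.leb_spec p (n + k)),
    (Nat.ltb_spec (2 * n) p), (Nat.leb_spec p (3 * n)),
    (Nat.ltb_spec (5 * n + 1 + k) p); cbn [andb orb]; intros <-; lia.
Qed.

Lemma tail_good n k c x y : k <= n -> good n (tail n k) c x y -> y <= 6 * n + 1 + k ->
  if c then (n < x /\ y <= 3 * n /\ x + 2 * n <= y + k) \/ (x <= 3 * n /\ 5 * n + 1 + k < y)
  else (x <= n /\ n + k < y <= 2 * n /\ x + n + k <= y) \/
       (x <= n /\ 3 * n < y <= 5 * n + 1 + k /\ x + 2 * n + k <= y) \/
       (n + k < x <= 2 * n /\ 3 * n < y <= 5 * n + 1 + k /\ x + 2 * n <= y) \/
       (3 * n < x /\ y <= 5 * n + 1 + k /\ x + n <= y).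
Proof.
  intros Hk (s & t & Px & Py & H) Hy.
  pose proof (tail_pos _ _ _ _ _ Hk Px); pose proof (tail_pos _ _ _ _ _ Hk Py).
  pose proof (pos_range _ _ _ _ Px); destruct c; lia.
Qed.

Lemma free_tail n k : 1 <= n -> 3 * k <= 2 * n -> free n (6 * n + 1 + k) (tail n k).
Proof.
  intros Hn Hk x y [(c & Gx) Lg] c' u v Gu Huy Hv.
  assert (Hk' : k <= n) by lia.
  assert (Huv : u + n <= v).
  { destruct Gu as (s & t & Pu & Pv & K); pose proof (pos_same _ _ _ _ _ _ Pu Pv); lia. }
  assert (Hxy : 1 <= x /\ x + n <= y).
  { destruct Gx as (s & t & Pu & Pv & K); pose proof (pos_same _ _ _ _ _ _ Pu Pv).
    pose proof (pos_range _ _ _ _ Pu); lia. }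
  pose proof (tail_good _ _ _ _ _ Hk' Gx ltac:(lia)) as H1.
  pose proof (tail_good _ _ _ _ _ Hk' Gu ltac:(lia)) as H2.
  (* A legal interval that is not wide comes after another good interval, which excludes an early
     start. *)
  assert (H0 : x + 2 * n <= y \/ 3 * n < x \/ 5 * n + 1 + k < y).
  { destruct Lg as [Lg|(c0 & u0 & v0 & G0 & K1 & K2)]; [now left|].
    pose proof (tail_good _ _ _ _ _ Hk' G0 ltac:(lia)) as H0.
    destruct c, c0; lia. }
  assert (H3 : x + 2 * n <= y \/ 5 * n + 1 + k < y \/ 4 * n + 1 < x \/
    x + n + k <= y \/ x + 2 * n <= y + k).
  { destruct Lg as [Lg|(c0 & u0 & v0 & G0 & K1 & K2)]; [now left|].
    pose proof (tail_good _ _ _ _ _ Hk' G0 ltac:(lia)) as H3.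
    destruct c, c0; lia. }
  clear Lg; destruct c, c'; lia.
Qed.

(* The first letters [1 0^n 1^n], followed by [n] zeros of the tail, force every
   good interval starting among them to have diameter at least [2 n]. *)
Definition extend n (v : nat -> bool) (i : nat) : bool :=
  if i <=? 1 then true else if i <=? n + 1 then false
  else if i <=? 2 * n + 1 then true else v (i - (2 * n + 1)).

Lemma extend_cn n v i : 1 <= n -> i <= 2 * n + 1 ->
  cn (extend n v) true i = Nat.min i 1 + (i - (n + 1)).
Proof.
  intros Hn; induction i as [|i IH]; intros Hi; [reflexivity|].
  cbn [cn]; rewrite IH by lia; unfold extend.
  destruct (Nat.leb_spec (S i) 1), (Nat.leb_spec (S i) (n + 1)),
    (Nat.leb_spec (S i) (2 * n + 1)); cbn [Bool.eqb]; lia.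
Qed.

Lemma extend_shift n v c i : 1 <= n ->
  cn (extend n v) c (2 * n + 1 + i) = cn (extend n v) c (2 * n + 1) + cn v c i.
Proof.
  intros Hn; induction i as [|i IH]; [rewrite Nat.add_0_r; simpl; lia|].
  replace (2 * n + 1 + S i) with (S (2 * n + 1 + i)) by lia.
  cbn [cn]; rewrite IH; unfold extend at 2.
  destruct (Nat.leb_spec (S (2 * n + 1 + i)) 1); [lia|].
  destruct (Nat.leb_spec (S (2 * n + 1 + i)) (n + 1)); [lia|].
  destruct (Nat.leb_spec (S (2 * n + 1 + i)) (2 * n + 1)); [lia|].
  replace (S (2 * n + 1 + i) - (2 * n + 1)) with (S i) by lia; lia.
Qed.

Lemma extend_good n v c x y : 1 <= n -> good n (extend n v) c x y -> 2 * n + 1 < x ->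
  good n v c (x - (2 * n + 1)) (y - (2 * n + 1)).
Proof.
  intros Hn (s & t & Px & Py & H) Hx.
  pose proof (pos_same _ _ _ _ _ _ Px Py).
  assert (Q : forall t p, pos (extend n v) c t p -> 2 * n + 1 < p ->
    pos v c (t - cn (extend n v) c (2 * n + 1)) (p - (2 * n + 1)) /\
    cn (extend n v) c (2 * n + 1) <= t).
  { intros t' p (P1 & P2 & P3) Hp.
    pose proof (extend_shift n v c (p - (2 * n + 1)) Hn) as E.
    replace (2 * n + 1 + (p - (2 * n + 1))) with p in E by lia.
    repeat split; try lia.
    revert P2; unfold extend.
    destruct (Nat.leb_spec p 1); [lia|]; destruct (Nat.leb_spec p (n + 1)); [lia|].
    destruct (Nat.leb_spec p (2 * n + 1)); [lia|auto]. }
  destruct (Q _ _ Px Hx) as (Qx & Lx); destruct (Q _ _ Py ltac:(lia)) as (Qy & Ly).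
  eexists; eexists; split; [exact Qx|split; [exact Qy|lia]].
Qed.

(** The one at 1 needs all ones up to [2n + 1]; a zero at [i] needs [i - 1] zeros behind the prefix;
    any other one of the prefix needs ones behind the [n] zeros that begin [v]. *)
Lemma extend_wide n v c x y : 1 <= n -> cn v true n = 0 -> good n (extend n v) c x y ->
  x <= 2 * n + 1 -> x + 2 * n <= y.
Proof.
  intros Hn Hv (s & t & Px & Py & H) Hx.
  destruct (le_lt_dec (x + 2 * n) y) as [|G]; [assumption|exfalso].
  pose proof (extend_cn n v (2 * n) Hn ltac:(lia)) as E2.
  pose proof (extend_cn n v (2 * n + 1) Hn ltac:(lia)) as E3.
  pose proof (extend_shift n v true n Hn) as E4.
  pose proof (extend_cn n v x Hn Hx) as E1.
  replace (2 * n + 1 + n) with (3 * n + 1) in E4 by lia.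
  assert (Hc : if c then x <= 1 \/ n + 1 < x else 1 < x <= n + 1).
  { destruct Px as (_ & Wx & _); revert Wx; unfold extend.
    destruct (Nat.leb_spec x 1), (Nat.leb_spec x (n + 1)), (Nat.leb_spec x (2 * n + 1));
      intros <-; lia. }
  pose proof (pos_le _ _ _ _ _ _ Px Py ltac:(lia)) as Hxy.
  pose proof (pos_range _ _ _ _ Px) as Rx.
  destruct Px as (_ & _ & Ex), Py as (_ & _ & Ey).
  remember (extend n v) as w eqn:Ew; clear Ew.
  destruct c.
  - destruct Hc as [Hc|Hc].
    + pose proof (cn_lip w true y (2 * n) ltac:(lia)); lia.
    + destruct (le_lt_dec y (3 * n + 1)) as [K|K].
      * pose proof (cn_lip w true y (3 * n + 1) K); lia.
      * pose proof (cn_lip w true (3 * n + 1) y ltac:(lia)); lia.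
  - pose proof (cn_sum w x); pose proof (cn_sum w y).
    destruct (le_lt_dec y (2 * n + 1)) as [K|K].
    + pose proof (cn_lip w false y (2 * n + 1) K); pose proof (cn_sum w (2 * n + 1)); lia.
    + pose proof (cn_lip w true (2 * n + 1) y ltac:(lia)); lia.
Qed.

(** A first interval starting in the prefix is wide, and then so is the second; otherwise all three
    lie in [v]. Either way the second is legal in [v]. *)
Lemma extend_no_triple n M v : 1 <= n -> cn v true n = 0 -> free n M v ->
  forall c1 x1 y1 c2 x2 y2 c3 x3 y3,
  good n (extend n v) c1 x1 y1 -> good n (extend n v) c2 x2 y2 ->
  good n (extend n v) c3 x3 y3 ->
  y1 < x2 -> y2 < x3 -> y3 <= 2 * n + 1 + M ->
  y1 - x1 <= y2 - x2 -> y2 - x2 <= y3 - x3 -> False.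
Proof.
  intros Hn Hv F c1 x1 y1 c2 x2 y2 c3 x3 y3 G1 G2 G3 H1 H2 H3 D1 D2.
  assert (W : forall c x y, good n (extend n v) c x y -> 1 <= x /\ x <= y).
  { intros c x y (s & t & Px & Py & H); pose proof (pos_same _ _ _ _ _ _ Px Py).
    pose proof (pos_range _ _ _ _ Px); lia. }
  pose proof (W _ _ _ G1); pose proof (W _ _ _ G2); pose proof (W _ _ _ G3).
  assert (K1 : x1 <= 2 * n + 1 -> x1 + 2 * n <= y1) by now apply (extend_wide n v c1).
  assert (K2 : 2 * n + 1 < x2) by lia.
  pose proof (extend_good _ _ _ _ _ Hn G2 K2) as G2'.
  pose proof (extend_good _ _ _ _ _ Hn G3 ltac:(lia)) as G3'.
  assert (Lg : legal n v (x2 - (2 * n + 1)) (y2 - (2 * n + 1))).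
  { split; [now exists c2|].
    destruct (le_lt_dec x1 (2 * n + 1)) as [K|K]; [left; lia|right].
    exists c1, (x1 - (2 * n + 1)), (y1 - (2 * n + 1)).
    split; [now apply extend_good|lia]. }
  pose proof (F _ _ Lg _ _ _ G3'); lia.
Qed.

(** * From intervals to sets *)

From mathcomp Require Import all_boot zify.
From mathcomp Require Import finmap.
Require Import Defs.

Set Implicit Arguments.
Unset Strict Implicit.
Unset Printing Implicit Defensive.

Lemma fsmax_eq (B : {fset nat}) b : b \in B -> (forall x, x \in B -> x <= b) -> fsmax B = b.
Proof.
move=> Bb leb; apply/eqP; rewrite eqn_leq; apply/andP; split.
  by apply/bigmax_leqP_seq => x Bx _; exact: leb.
by rewrite /fsmax; apply: (leq_bigmax_seq (F := id)).
Qed.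

Lemma bigmin_le (s : seq nat) m a : a \in s -> \big[minn/m]_(x <- s) x <= a.
Proof.
elim: s => // x s IH; rewrite inE big_cons => /orP[/eqP->|/IH]; first exact: geq_minl.
exact/leq_trans/geq_minr.
Qed.

Lemma bigmin_in (s : seq nat) m : \big[minn/m]_(x <- s) x \in m :: s.
Proof.
elim: s => [|x s IH]; first by rewrite big_nil inE.
rewrite big_cons; case: leqP => _; first by rewrite !inE eqxx orbT.
by move: IH; rewrite !inE => /orP[->|->]; rewrite ?orbT.
Qed.

Lemma bigmax_in (s : seq nat) : s != [::] -> \max_(x <- s) x \in s.
Proof.
elim: s => // x [|y s] IH _; first by rewrite big_seq1 inE.
rewrite big_cons; case: leqP => _; last by rewrite inE eqxx.
by rewrite inE IH ?orbT.
Qed.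

Lemma fsmin_eq (B : {fset nat}) a : a \in B -> (forall x, x \in B -> a <= x) -> fsmin B = a.
Proof.
move=> Ba gea; apply/eqP; rewrite eqn_leq bigmin_le //=.
have := bigmin_in B (fsmax B); rewrite inE => /orP[/eqP E|/gea //].
by rewrite /fsmin E; apply: (leq_bigmax_seq (F := id)).
Qed.

Lemma fsmax_in (B : {fset nat}) : B != fset0 -> fsmax B \in B.
Proof.
move=> B0; apply: bigmax_in; apply: contra B0 => /eqP E.
by apply/eqP/fsetP => x; rewrite -[x \in B]/(x \in (B : seq nat)) E.
Qed.

Lemma fsmin_in (B : {fset nat}) : B != fset0 -> fsmin B \in B.
Proof.
move=> B0; have := bigmin_in B (fsmax B).
by rewrite inE => /orP[/eqP E|//]; rewrite /fsmin E; exact: fsmax_in.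
Qed.

(** The offset [o] serves both the whole word and its part behind the first [2n + 1] letters. *)
Lemma fset_of_run (D : nat -> bool) o c s x j z :
  let w i := D (i + o) in
  pos w c s x -> pos w c (s + j) z ->
  exists B : {fset nat}, [/\ #|` B| = j.+1,
    forall i, i \in B -> x + o <= i <= z + o /\ D i = c, x + o \in B & z + o \in B].
Proof.
move=> w Px; elim: j z => [|j IH] z Pz.
  have Exz : x = z by have := pos_same _ _ _ _ _ _ Px Pz; lia.
  exists [fset (x + o)%N]%fset; split; rewrite -?Exz ?cardfs1 ?in_fset1 //.
  by move=> i; rewrite in_fset1 => /eqP ->; split; [lia|case: Px => _ []].
have [z' [Pz' _]] : exists p, pos w c (s + j) p /\ (p <= z)%coq_nat.
  by apply: pos_ex; have := pos_range _ _ _ _ Px; case: Pz => _ [_ ->]; lia.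
have ltz : z' < z by have := pos_same _ _ _ _ _ _ Pz' Pz; lia.
have [B [cB HB xB zB]] := IH z' Pz'.
exists ((z + o)%N |` B)%fset; split.
- rewrite cardfsU1 cB; case: (boolP (z + o \in B)) => // /HB; lia.
- move=> i; rewrite in_fset1U => /orP[/eqP->|/HB [? ?]]; split=> //; last lia.
    by have := HB _ xB; lia.
  by case: Pz => _ [].
- by rewrite in_fset1U xB orbT.
- by rewrite in_fset1U eqxx.
Qed.

(** The set consists of the first [n] letters of the colour from [x] on, together with [y]. *)
Lemma mset_of_good (D : nat -> bool) o n N c x y : 1 <= n ->
  good n (fun i => D (i + o)) c x y -> y + o <= N ->
  exists B : {fset nat}, [/\ mono_mset n.+1 N D B, fsmin B = x + o & fsmax B = y + o].
Proof.
case: n => // n _ [s [t [Px [Py Hst]]]] HyN.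
have Rx := pos_range _ _ _ _ Px.
have [z [Pz _]] : exists p, pos (fun i => D (i + o)) c (s + n) p /\ (p <= y)%coq_nat.
  by apply: pos_ex; case: (Py) => _ [_ ->]; lia.
have ltz : z < y by have := pos_same _ _ _ _ _ _ Pz Py; lia.
have [B [cB HB xB zB]] := fset_of_run Px Pz.
have xz := HB _ xB.
exists ((y + o)%N |` B)%fset; split.
- split.
  + by move=> i; rewrite in_fset1U => /orP[/eqP->|/HB]; lia.
  + rewrite cardfsU1 cB; case: (boolP (y + o \in B)) => // /HB; lia.
  + exists c => i; rewrite in_fset1U => /orP[/eqP->|/HB [] //].
    by case: Py => _ [].
- apply: fsmin_eq; first by rewrite in_fset1U xB orbT.
  by move=> i; rewrite in_fset1U => /orP[/eqP->|/HB]; lia.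
- apply: fsmax_eq; first by rewrite in_fset1U eqxx.
  by move=> i; rewrite in_fset1U => /orP[/eqP->|/HB]; lia.
Qed.

Lemma cn_count (w : nat -> bool) c i : cn w c i = count (fun p => w p == c) (iota 1 i).
Proof.
elim: i => // i IH.
have -> : iota 1 i.+1 = iota 1 i ++ [:: i.+1] by rewrite -{1}[i.+1]addn1 iotaD add1n.
by rewrite count_cat /= -IH addn0; case: (w i.+1); case: c {IH}.
Qed.

Lemma good_of_mset (D : nat -> bool) n N (B : {fset nat}) : mono_mset n.+1 N D B ->
  (exists c, good n D c (fsmin B) (fsmax B)) /\ fsmax B <= N.
Proof.
case=> HN cB [c Hc].
have B0 : B != fset0 by apply/eqP => E; rewrite E cardfs0 in cB.
have minB := fsmin_in B0; have maxB := fsmax_in B0.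
split; last by have := HN _ maxB; lia.
have lex x : x \in B -> fsmin B <= x <= fsmax B.
  by move=> Bx; rewrite bigmin_le //=; apply: (leq_bigmax_seq (F := id)).
exists c, (cn D c (fsmin B)), (cn D c (fsmax B)).
have Pmin : pos D c (cn D c (fsmin B)) (fsmin B).
  by split; [have := HN _ minB; lia | split; [exact: Hc|]].
split=> //; split.
  by split; [have := HN _ maxB; lia | split; [exact: Hc|]].
have [p [Ep Ec]] := pos_pred _ _ _ _ Pmin.
have le_mM := lex _ maxB.
(* All elements of [B] are letters of colour [c] between its ends, so the ranks of the ends differ
   by at least [n]. *)
have : size B <= size [seq i <- iota (fsmin B) (fsmax B - p) | D i == c].
  apply: uniq_leq_size => [|x Bx]; first exact: fset_uniq.
  rewrite mem_filter mem_iota Hc // eqxx /=; have := lex _ Bx; lia.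
rewrite size_filter -[size B]/#|` B| cB.
have : iota 1 (fsmax B) = iota 1 p ++ iota (fsmin B) (fsmax B - p).
  by rewrite Ep -add1n -iotaD; congr iota; lia.
move=> /(congr1 (count (fun i => D i == c))); rewrite count_cat -!cn_count; lia.
Qed.

(** * Bounds for the least length *)

Lemma forces_upper n k : 1 <= n -> (forall w, ~ free n (6 * n + 2 + k) w) ->
  forces_triple n.+1 (8 * n + 3 + k).
Proof.
move=> n1 NF D; apply: NNPP => NT.
(* Pigeonhole on the first [2n + 1] letters; the set [A] found there has diameter at most [2n] and
   precedes any wide pair. *)
have [c Hc] : exists c, n.+1 <= cn (fun i => D (i + 0)) c (2 * n + 1).
  have := cn_sum (fun i => D (i + 0)) (2 * n + 1).
  have [le|gt] := leqP n.+1 (cn (fun i => D (i + 0)) true (2 * n + 1)); first by exists true.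
  by exists false; lia.
have [x1 [Px1 _]] : exists p, pos (fun i => D (i + 0)) c 1 p /\ (p <= 2 * n + 1)%coq_nat.
  by apply: pos_ex; lia.
have [y1 [Py1 le1]] : exists p, pos (fun i => D (i + 0)) c n.+1 p /\ (p <= 2 * n + 1)%coq_nat.
  by apply: pos_ex; lia.
have Rx1 := pos_range _ _ _ _ Px1.
have GA : good n (fun i => D (i + 0)) c x1 y1.
  by exists 1, n.+1; split=> //; split=> //; lia.
have [|A [mA minA maxA]] := mset_of_good (N := 8 * n + 3 + k) n1 GA; first lia.
apply: (NF (fun i => D (i + (2 * n + 1)))) => x y [[c2 G2] Lg] c3 u v G3 yu vM.
have [[x0 Gux] Gvx] : ((1 <= x)%coq_nat /\ (x + n <= y)%coq_nat) /\ (u + n <= v)%coq_nat.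
  case: G2 G3 => s [t [Px [Py Hst]]] [s' [t' [Pu [Pv Hst']]]].
  have := pos_same _ _ _ _ _ _ Px Py; have := pos_same _ _ _ _ _ _ Pu Pv.
  by have := pos_range _ _ _ _ Px; lia.
apply/ltP; rewrite ltnNge; apply/negP => le23; apply: NT.
have [|B2 [m2 min2 max2]] := mset_of_good (N := 8 * n + 3 + k) n1 G2; first lia.
have [|B3 [m3 min3 max3]] := mset_of_good (N := 8 * n + 3 + k) n1 G3; first lia.
case: Lg => [wide|[c1 [u1 [v1 [G1 [v1x d12]]]]]].
  exists A, B2, B3; split; first by [].
  by rewrite /precedes /diam minA maxA min2 max2 min3 max3; split; lia.
have Guv : (u1 + n <= v1)%coq_nat.
  by case: G1 => s [t [Px [Py Hst]]]; have := pos_same _ _ _ _ _ _ Px Py; lia.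
have [|B1 [m1 min1 max1]] := mset_of_good (N := 8 * n + 3 + k) n1 G1; first lia.
exists B1, B2, B3; split; first by [].
by rewrite /precedes /diam min1 max1 min2 max2 min3 max3; split; lia.
Qed.

Lemma forces_lower n M v N : 1 <= n -> cn v true n = 0 -> free n M v ->
  forces_triple n.+1 N -> 2 * n + 2 + M <= N.
Proof.
move=> n1 v0 F H; rewrite leqNgt; apply/negP => ltN.
have [B1 [B2 [B3 [[m1 m2 m3] [p12 p23 d12 d23]]]]] := H (extend n v).
have [[c1 G1] _] := good_of_mset m1.
have [[c2 G2] _] := good_of_mset m2.
have [[c3 G3] le3] := good_of_mset m3.
have n1' : (1 <= n)%coq_nat by lia.
move: p12 p23 d12 d23; rewrite /precedes /diam => p12 p23 d12 d23.
by apply: (extend_no_triple _ _ _ n1' v0 F _ _ _ _ _ _ _ _ _ G1 G2 G3); lia.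
Qed.

Theorem theorem2p3 (m : nat) (hm : 2 <= m) :
  is_f m (8 * m - 5 + (2 * m - 2) %/ 3 + delta m).
Proof.
case: m hm => // n; rewrite ltnS => n1.
(* [k] is the excess over [8n + 3]; it remains to give a free word of length [6n + 1 + k] and to
   exclude free words one letter longer. *)
suff [k [v [M [Ek EM v0 F NF]]]] : exists k v M,
    [/\ 8 * n.+1 - 5 + (2 * n.+1 - 2) %/ 3 + delta n.+1 = 8 * n + 3 + k,
      M = 6 * n + 1 + k, cn v true n = 0, free n M v & forall w, ~ free n (6 * n + 2 + k) w].
  rewrite Ek; split; first exact: forces_upper.
  by move=> N /(forces_lower n1 v0 F); lia.
have [->|n_neq1] := eqVneq n 1.
  by exists 1, tail1, 8; split=> //; [exact: free_tail1 | exact: not_free1].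
(* For [n = 4] the quotient is 2, which fails [n + 1 <= 2k]; the value is therefore one larger, with
   [k = 3]. *)
have [->|n_neq4] := eqVneq n 4.
  exists 3, tail4, 28; split=> //; first exact: free_tail4.
  by move=> w; apply: (not_free 4 3 w); lia.
have d0 : delta n.+1 = 0 by rewrite /delta !eqSS (negbTE n_neq1) (negbTE n_neq4).
exists ((2 * n) %/ 3), (tail n ((2 * n) %/ 3)), (6 * n + 1 + (2 * n) %/ 3); split=> //.
- rewrite d0; have -> : 2 * n.+1 - 2 = 2 * n by lia.
  lia.
- rewrite tail_cn; lia.
- apply: free_tail; lia.
- have [->|n_neq2] := eqVneq n 2; first exact: not_free2.
  move=> w; apply: not_free; lia.
Qed.
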